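(* There exist infinitely many quadratic fields $\mathbb{K}$ such that for each of them there exist infinitely many Diophantine triples over $\mathbb{K}$ whose induced elliptic curves have torsion group $E(\mathbb{K})_{\mathrm{tors}}\cong \mathbb{Z}/2\mathbb{Z}\times\mathbb{Z}/12\mathbb{Z}$.
   Context: For a field $\mathbb{K}$, a Diophantine triple over $\mathbb{K}$ is a set $\{a,b,c\}$ of three distinct nonzero elements of $\mathbb{K}$ such that $ab+1$, $ac+1$ and $bc+1$ are all squares in $\mathbb{K}$. The elliptic curve induced by the Diophantine triple $\{a,b,c\}$ is $E:\ y^2=(ax+1)(bx+1)(cx+1)$ over $\mathbb{K}$. A quadratic field is a field extension of $\mathbb{Q}$ of degree $2$. *)

(* Defs.v *)
From HB Require Import structures.
From mathcomp Require Import all_boot all_order all_algebra algC.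
Set Implicit Arguments. Unset Strict Implicit. Unset Printing Implicit Defensive.
Import Order.TTheory GRing.Theory Num.Theory.
Local Open Scope ring_scope.

(* Number fields are modelled as subfields of algC (the algebraic closure
   of Q); a subfield is given by its membership predicate. *)

Definition is_subfield (K : algC -> Prop) : Prop :=
  [/\ K 0, K 1,
      (forall x y, K x -> K y -> K (x - y)),
      (forall x y, K x -> K y -> K (x * y)) &
      (forall x, K x -> x != 0 -> K x^-1)].

Definition quadratic_field (K : algC -> Prop) : Prop :=
  is_subfield K /\
  exists alpha : algC,
    [/\ K alpha,
        (forall p q : rat, ratr p + ratr q * alpha = 0 -> p = 0 /\ q = 0) &
        (forall x, K x -> exists p q : rat, x = ratr p + ratr q * alpha)].

Definition is_square_in (K : algC -> Prop) (x : algC) : Prop :=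
  exists r, K r /\ r ^+ 2 = x.

Definition diophantine_triple (K : algC -> Prop) (a b c : algC) : Prop :=
  [/\ [/\ K a, K b & K c],
      [/\ a != 0, b != 0 & c != 0],
      [/\ a != b, a != c & b != c] &
      [/\ is_square_in K (a * b + 1), is_square_in K (a * c + 1)
        & is_square_in K (b * c + 1)]].

(* Points of E : y^2 = (ax+1)(bx+1)(cx+1); None is the point at infinity. *)
Definition ecpoint := option (algC * algC).

Definition on_curve (K : algC -> Prop) (a b c : algC) (P : ecpoint) : Prop :=
  match P with
  | None => True
  | Some (x, y) => [/\ K x, K y & y ^+ 2 = (a * x + 1) * (b * x + 1) * (c * x + 1)]
  end.

(* Chord-and-tangent group law on y^2 = A x^3 + B x^2 + C x + 1 with
   A = abc, B = ab+ac+bc, C = a+b+c; neutral element = point at infinity. *)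
Definition ec_add (a b c : algC) (P Q : ecpoint) : ecpoint :=
  let A := a * b * c in
  let B := a * b + a * c + b * c in
  let C := a + b + c in
  match P, Q with
  | None, _ => Q
  | _, None => P
  | Some (x1, y1), Some (x2, y2) =>
    if (x1 == x2) && (y1 == - y2) then None
    else
      let l := if x1 == x2
               then (3%:R * A * x1 ^+ 2 + 2%:R * B * x1 + C) / (2%:R * y1)
               else (y2 - y1) / (x2 - x1) in
      let x3 := (l ^+ 2 - B) / A - x1 - x2 in
      Some (x3, - (y1 + l * (x3 - x1)))
  end.

Definition ec_mul (a b c : algC) (n : nat) (P : ecpoint) : ecpoint :=
  iter n (ec_add a b c P) None.

Definition ec_torsion (K : algC -> Prop) (a b c : algC) (P : ecpoint) : Prop :=
  on_curve K a b c P /\ exists n : nat, (0 < n)%N /\ ec_mul a b c n P = None.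

Definition torsion_Z2xZ12 (K : algC -> Prop) (a b c : algC) : Prop :=
  exists phi : 'Z_2 * 'Z_12 -> ecpoint,
    [/\ (forall u, ec_torsion K a b c (phi u)),
        injective phi,
        (forall P, ec_torsion K a b c P -> exists u, phi u = P) &
        (forall u v, phi (u + v) = ec_add a b c (phi u) (phi v))].

(* Main.v *)
Require Import Defs.
From HB Require Import structures.
From mathcomp Require Import all_boot all_order all_algebra algC.
From mathcomp Require Import separable ring zify.
From Stdlib Require Import ClassicalEpsilon.
Set Implicit Arguments. Unset Strict Implicit. Unset Printing Implicit Defensive.
Import Order.TTheory GRing.Theory Num.Theory.
Local Open Scope ring_scope.

(** If [m^2 = a (a + 2)] and [w^2 = 2 a + 1], the triple
    [{1/m, -m, (1 - a^2)/m}] is Diophantine and its curve, isomorphic to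
    [y^2 = x (x + a^3 (a + 2)) (x + 2 a + 1)], carries explicit points of orders
    2, 4 and 3 generating [Z/2 x Z/12].  Such [(a, m, w)] are points of the genus
    one curve [Y^2 = X (X^2 - X + 1)], with [a = 2 X / (X - 1)^2],
    [w = (X + 1) / (X - 1)] and [m = 2 Y / (X - 1)^2].  For rational [X] all of
    this lives over [Q(Y)], and doubling on the genus one curve changes
    [X (X^2 - X + 1)] by a rational square, so the orbit of [X] under doubling
    gives infinitely many triples over the same quadratic field.

    The class [X = 9] is fixed by doubling modulo 19, and there 19 splits in
    [Q(Y)] and the reduced curve has exactly 24 points over [F_19].  Since torsion
    injects under reduction at an unramified place of good reduction
    (Nagell-Lutz), the torsion has at most 24 elements.

    Fields are separated by ramification: [X = l / (36 (l mod 19))], with [l] a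
    large prime, gives a field in which [l] ramifies.  The triples of one orbit are
    separated by the 2-adic valuation of [X], which drops by 2 at each doubling.

    The group law on the curve is derived from ideal classes: the ideals
    [(x - x0, y - y0)] of [F[x, y] / (y^2 - f)] multiply, up to principal ideals,
    as the points add. *)

(** * Ideals up to principal ideals *)

(** Explicit points bound the torsion from below; the obstacle is the upper bound, needed for every
    curve of every orbit over every field. Fixing the residue class of [X] modulo 19 lets one point
    count serve them all, in place of a classification of torsion over quadratic fields. At [X = 9]
    the form [X (X^2 - X + 1)] is 657, which is 7^2 modulo 19, hence the splitting; moreover [a]
    becomes 8, and the nondegeneracy conditions are read off from this residue. Reduction is used
    only as an injective map of sets, so no group law over ['F_19] and no homomorphism property are
    involved; injectivity comes from the integrality of [P - Q]. Checking associativity of the chord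
    and tangent law by formulas splits into many cases. Multiplication of ideals is associative for
    free, so it is enough that points map to ideal classes injectively and compatibly with addition.
    Injectivity is a degree argument on norms; compatibility is the triviality of the class attached
    to three collinear points. *)

Section Ideals.
Variable R : comNzRingType.
Implicit Types s t r : seq R.

(** Ideals are kept as lists of generators so that products of point ideals can be expanded
    generator by generator. *)
Fixpoint ideal_gen s (z : R) : Prop :=
  if s is g :: s' then exists c, ideal_gen s' (z - c * g) else z = 0.

Lemma ideal_gen0 s : ideal_gen s 0.
Proof. by elim: s => //= g s IH; exists 0; rewrite mul0r subr0. Qed.

Lemma ideal_genD s x y : ideal_gen s x -> ideal_gen s y -> ideal_gen s (x + y).
Proof.
elim: s x y => [|g s IH] x y /=; first by move=> -> ->; rewrite addr0.
move=> [c Hc] [d Hd]; exists (c + d).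
by have := IH _ _ Hc Hd; rewrite mulrDl opprD addrACA.
Qed.

Lemma ideal_genM s c x : ideal_gen s x -> ideal_gen s (c * x).
Proof.
elim: s x => [|g s IH] x /=; first by move=> ->; rewrite mulr0.
by move=> [d Hd]; exists (c * d); have := IH _ Hd; rewrite mulrBr mulrA.
Qed.

Lemma ideal_genB s x y : ideal_gen s x -> ideal_gen s y -> ideal_gen s (x - y).
Proof. by move=> hx hy; rewrite -mulN1r; apply: ideal_genD => //; apply: ideal_genM. Qed.

Lemma ideal_gen_mem s g : g \in s -> ideal_gen s g.
Proof.
elim: s => //= h s IH; rewrite inE => /orP[/eqP->|/IH hg].
  by exists 1; rewrite mul1r subrr; apply: ideal_gen0.
by exists 0; rewrite mul0r subr0.
Qed.

Lemma ideal_gen_sub s t z :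
  (forall g, g \in s -> ideal_gen t g) -> ideal_gen s z -> ideal_gen t z.
Proof.
elim: s z => [|h s IH] z /= st; first by move=> ->; apply: ideal_gen0.
move=> [c Hc]; rewrite -(subrK (c * h) z); apply: ideal_genD.
  by apply: IH Hc => g gs; apply: st; rewrite inE gs orbT.
by apply: ideal_genM; apply: st; rewrite inE eqxx.
Qed.

Definition ideal_eq s t := forall z, ideal_gen s z <-> ideal_gen t z.

Lemma ideal_eqP s t : (forall g, g \in s -> ideal_gen t g) ->
  (forall g, g \in t -> ideal_gen s g) -> ideal_eq s t.
Proof. by move=> st ts z; split; apply: ideal_gen_sub. Qed.

Definition ideal_mul s t := [seq g * h | g <- s, h <- t].

Lemma ideal_gen_mul s t x y :
  ideal_gen s x -> ideal_gen t y -> ideal_gen (ideal_mul s t) (x * y).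
Proof.
move=> hx; have {hx}: ideal_gen (ideal_mul s [:: y]) (x * y).
  elim: s x hx => [|g s IH] x /=; first by move=> ->; rewrite mul0r.
  by move=> [c /IH Hc]; exists c; rewrite mulrA -mulrBl.
move=> hxy hy; apply: ideal_gen_sub hxy => _ /allpairsP[[g h] /= [gs + ->]].
rewrite inE => /eqP->; elim: t y hy => [|k t IH] y /=.
  by move=> ->; rewrite mulr0; apply: ideal_gen0.
move=> [c /IH Hc]; rewrite -(subrK (c * k) y) mulrDr; apply: ideal_genD.
  apply: ideal_gen_sub Hc => _ /allpairsP[[g' h'] /= [gs' ht' ->]].
  by apply: ideal_gen_mem; apply/allpairsP; exists (g', h'); rewrite inE ht' orbT.
rewrite mulrCA; apply: ideal_genM; apply: ideal_gen_mem.
by apply/allpairsP; exists (g, k); rewrite inE eqxx.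
Qed.

Lemma ideal_mul_sub s t r z :
  (forall g h, g \in s -> h \in t -> ideal_gen r (g * h)) ->
  ideal_gen (ideal_mul s t) z -> ideal_gen r z.
Proof. by move=> H; apply: ideal_gen_sub => _ /allpairsP[[g h] /= [gs ht ->]]; apply: H. Qed.

Lemma ideal_eq_sym s t : ideal_eq s t -> ideal_eq t s.
Proof. by move=> st z; split; rewrite st. Qed.

Lemma ideal_eq_trans t s r : ideal_eq s t -> ideal_eq t r -> ideal_eq s r.
Proof. by move=> st tr z; rewrite st tr. Qed.

Lemma ideal_mulC s t : ideal_eq (ideal_mul s t) (ideal_mul t s).
Proof.
by move=> z; split; apply: ideal_mul_sub => g h gs ht; rewrite mulrC;
  apply: ideal_gen_mul; apply: ideal_gen_mem.
Qed.

Lemma ideal_mulA s t r :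
  ideal_eq (ideal_mul s (ideal_mul t r)) (ideal_mul (ideal_mul s t) r).
Proof.
move=> z; split.
  apply: ideal_mul_sub => g _ gs /allpairsP[[h k] /= [ht kr ->]]; rewrite mulrA.
  by do 2?[apply: ideal_gen_mul]; apply: ideal_gen_mem.
apply: ideal_mul_sub => _ g /allpairsP[[h k] /= [ht kr ->]] gs; rewrite -mulrA.
by do 2?[apply: ideal_gen_mul]; apply: ideal_gen_mem.
Qed.

Lemma ideal_mul_eq s s' t t' :
  ideal_eq s s' -> ideal_eq t t' -> ideal_eq (ideal_mul s t) (ideal_mul s' t').
Proof.
move=> ss' tt' z; split; apply: ideal_mul_sub => g h gs ht; apply: ideal_gen_mul.
- by apply/ss'; apply: ideal_gen_mem.
- by apply/tt'; apply: ideal_gen_mem.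
- by apply/ss'; apply: ideal_gen_mem.
- by apply/tt'; apply: ideal_gen_mem.
Qed.

Lemma ideal_mul1 s : ideal_eq (ideal_mul [:: 1] s) s.
Proof.
by rewrite /ideal_mul /= cats0 (eq_map (g := id)) ?map_id // => x; rewrite mul1r.
Qed.

Hypothesis R_domain : forall x y : R, x * y = 0 -> x = 0 \/ y = 0.

(** Equality of ideal classes with denominators cleared, which avoids fraction fields. Being a
    domain is a hypothesis and not a structure because [coord_ring f] is shown to be a domain only
    for cubic [f]. *)
Definition ideal_sim s t := exists u v, [/\ u != 0, v != 0 &
  ideal_eq (ideal_mul [:: u] s) (ideal_mul [:: v] t)].

Lemma domain_mul_neq0 (x y : R) : x != 0 -> y != 0 -> x * y != 0.
Proof.
move=> /eqP hx /eqP hy; apply/eqP => /R_domain [] //.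
Qed.

Lemma ideal_sim_refl s : ideal_sim s s.
Proof. by exists 1, 1; rewrite oner_neq0. Qed.

Lemma ideal_eq_sim s t : ideal_eq s t -> ideal_sim s t.
Proof. by move=> st; exists 1, 1; rewrite oner_neq0; split => //; apply: ideal_mul_eq. Qed.

Lemma ideal_sim_sym s t : ideal_sim s t -> ideal_sim t s.
Proof. by move=> [u [v [u0 v0 H]]]; exists v, u; split => //; apply: ideal_eq_sym. Qed.

Lemma ideal_mulACA s t r q : ideal_eq (ideal_mul (ideal_mul s t) (ideal_mul r q))
  (ideal_mul (ideal_mul s r) (ideal_mul t q)).
Proof.
move=> z; rewrite -ideal_mulA -ideal_mulA; apply: ideal_mul_eq => // {}z.
by rewrite !ideal_mulA; apply: ideal_mul_eq => //; apply: ideal_mulC.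
Qed.

Lemma ideal_mul_sim s s' t t' :
  ideal_sim s s' -> ideal_sim t t' -> ideal_sim (ideal_mul s t) (ideal_mul s' t').
Proof.
move=> [u [v [u0 v0 H]]] [u' [v' [u'0 v'0 H']]].
exists (u * u'), (v * v'); rewrite !domain_mul_neq0 //; split => //.
change (ideal_eq (ideal_mul (ideal_mul [:: u] [:: u']) (ideal_mul s t))
                 (ideal_mul (ideal_mul [:: v] [:: v']) (ideal_mul s' t'))).
apply: ideal_eq_trans (ideal_mulACA _ _ _ _) _.
exact: ideal_eq_trans (ideal_mul_eq H H') (ideal_mulACA _ _ _ _).
Qed.

Lemma ideal_sim_trans t s r : ideal_sim s t -> ideal_sim t r -> ideal_sim s r.
Proof.
move=> [u [v [u0 v0 H]]] [u' [v' [u'0 v'0 H']]].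
exists (u' * u), (v * v'); rewrite !domain_mul_neq0 //; split => //.
change (ideal_eq (ideal_mul (ideal_mul [:: u'] [:: u]) s)
                 (ideal_mul (ideal_mul [:: v] [:: v']) r)).
apply: ideal_eq_trans (ideal_eq_sym (ideal_mulA _ _ _)) _.
apply: ideal_eq_trans (ideal_mul_eq (fun z => iff_refl _) H) _.
apply: ideal_eq_trans (ideal_mulA _ _ _) _.
apply: ideal_eq_trans (ideal_mul_eq (ideal_mulC _ _) (fun z => iff_refl _)) _.
apply: ideal_eq_trans (ideal_eq_sym (ideal_mulA _ _ _)) _.
apply: ideal_eq_trans (ideal_mul_eq (fun z => iff_refl _) H') _.
exact: ideal_mulA.
Qed.

Lemma principal_sim1 (g : R) : g != 0 -> ideal_sim [:: g] [:: 1].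
Proof. by move=> g0; exists 1, g; rewrite oner_neq0; split => //= z; rewrite /= mul1r mulr1. Qed.

Lemma ideal_sim_mul1 s : ideal_sim (ideal_mul [:: 1] s) s.
Proof. by apply: ideal_eq_sim; apply: ideal_mul1. Qed.

Lemma ideal_sim_mulC s t : ideal_sim (ideal_mul s t) (ideal_mul t s).
Proof. by apply: ideal_eq_sim; apply: ideal_mulC. Qed.

Lemma ideal_sim_mulA s t r :
  ideal_sim (ideal_mul s (ideal_mul t r)) (ideal_mul (ideal_mul s t) r).
Proof. by apply: ideal_eq_sim; apply: ideal_mulA. Qed.

End Ideals.

(** * The coordinate ring of [y^2 = f] *)

(** The pair [(p, q)] stands for [p + q y]. The parameter [f] does not occur in the carrier; it
    selects the multiplication, which replaces [y^2] by [f]. *)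
Definition coord_ring (F : fieldType) (f : {poly F}) : Type := ({poly F} * {poly F})%type.

HB.instance Definition _ (F : fieldType) (f : {poly F}) :=
  GRing.Zmodule.copy (coord_ring f) ({poly F} * {poly F})%type.

Section CoordRing.
Variables (F : fieldType) (f : {poly F}).
Local Notation R := (coord_ring f).
Implicit Types z w : R.

Definition coord_mul z w : R := (z.1 * w.1 + z.2 * w.2 * f, z.1 * w.2 + z.2 * w.1).
Definition coord_one : R := (1, 0).

Lemma coord_eqP z w : z.1 = w.1 -> z.2 = w.2 -> z = w.
Proof. by case: z w => [? ?] [? ?] /= -> ->. Qed.

Fact coord_mulA : associative coord_mul.
Proof. by move=> z w t; apply: coord_eqP => /=; ring. Qed.
Fact coord_mulC : commutative coord_mul.
Proof. by move=> z w; apply: coord_eqP => /=; ring. Qed.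
Fact coord_mul1 : left_id coord_one coord_mul.
Proof. by move=> z; apply: coord_eqP => /=; ring. Qed.
Fact coord_mulDl : left_distributive coord_mul +%R.
Proof. by move=> z w t; apply: coord_eqP => /=; ring. Qed.
Fact coord_one_neq0 : coord_one != 0 :> R.
Proof. by apply/eqP => /(congr1 fst) /eqP; rewrite oner_eq0. Qed.

HB.instance Definition _ := GRing.Zmodule_isComNzRing.Build R
  coord_mulA coord_mulC coord_mul1 coord_mulDl coord_one_neq0.

Definition coord_cst (p : {poly F}) : R := (p, 0).
Definition coord_y : R := (0, 1).

Fact coord_cst_additive : {morph coord_cst : x y / x - y}.
Proof. by move=> p q; apply: coord_eqP => //=; rewrite subr0. Qed.
HB.instance Definition _ := GRing.isAdditive.Build _ _ coord_cst coord_cst_additive.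
Fact coord_cst_multiplicative : multiplicative coord_cst.
Proof. by split=> // p q; apply: coord_eqP => /=; ring. Qed.
HB.instance Definition _ := GRing.isMultiplicative.Build _ _ coord_cst coord_cst_multiplicative.

Lemma coord_y_sqr : coord_y * coord_y = coord_cst f.
Proof. by apply: coord_eqP => /=; ring. Qed.

Definition coord_norm z : {poly F} := z.1 ^+ 2 - z.2 ^+ 2 * f.
Definition coord_conj z : R := (z.1, - z.2).

Lemma coord_normM z w : coord_norm (z * w) = coord_norm z * coord_norm w.
Proof. by rewrite /coord_norm /=; ring. Qed.

Lemma coord_mul_conj z : z * coord_conj z = coord_cst (coord_norm z).
Proof. by apply: coord_eqP; rewrite /= /coord_norm; ring. Qed.

Hypothesis f_cubic : size f = 4%N.

(* The degrees of [p^2] and [q^2 f] have different parities, so nothing cancels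
   in [p^2 - q^2 f], and its degree is never 1. *)
Lemma size_coord_norm z : z != 0 ->
  size (coord_norm z) != 0 /\ size (coord_norm z) != 2%N.
Proof.
case: z => p q nz0; rewrite /coord_norm /=.
have f0 : f != 0 by rewrite -size_poly_gt0 f_cubic.
have sp : p != 0 -> size (p ^+ 2) = (size p).*2.-1.
  by move=> p0; rewrite expr2 size_mul // addnn.
have sq : q != 0 -> size (- (q ^+ 2 * f)) = (size q).*2.+2.
  move=> q0; rewrite size_polyN size_mul ?sqrf_eq0 // f_cubic expr2 size_mul // addnn.
  by case: (size q) (size_poly_gt0 q) => [|n]; rewrite ?q0 //= doubleS !addnS addn0.
have [p0|p0] := eqVneq p 0.
  have q0 : q != 0 by apply: contra nz0 => /eqP->; rewrite p0.
  by rewrite p0 expr0n add0r sq //=; case: (size q) (size_poly_gt0 q) => [|n]; rewrite ?q0.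
have [q0|q0] := eqVneq q 0.
  rewrite q0 expr0n mul0r subr0 sp //.
  by move: (size_poly_gt0 p); rewrite p0; case: (size p) => [|[|n]].
have sp1 : (0 < size p)%N by rewrite size_poly_gt0.
have sq1 : (0 < size q)%N by rewrite size_poly_gt0.
case: (ltngtP (size (p ^+ 2)) (size (- (q ^+ 2 * f)))) => H.
- rewrite addrC size_polyDl // sq //; by case: (size q) sq1.
- rewrite size_polyDl // sp //; by case: (size p) sp1 => [|[|n]].
- move: H; rewrite sp // sq // => /(congr1 odd).
  by case: (size p) sp1 => [//|n] _; rewrite doubleS /= !odd_double.
Qed.

Lemma coord_norm_eq0 z : coord_norm z = 0 -> z = 0.
Proof.
by move=> H; apply/eqP; apply: contraT => /size_coord_norm[]; rewrite H size_poly0.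
Qed.

Lemma coord_domain z w : z * w = 0 -> z = 0 \/ w = 0.
Proof.
move=> H; have /eqP := coord_normM z w; rewrite H {1}/coord_norm /= expr0n mul0r subr0 eq_sym.
by rewrite mulf_eq0 => /orP[] /eqP /coord_norm_eq0; [left|right].
Qed.

Lemma coord_mulI z w t : z != 0 -> z * w = z * t -> w = t.
Proof.
move=> /eqP z0 /eqP; rewrite -subr_eq0 -mulrBr => /eqP /coord_domain [//|/eqP].
by rewrite subr_eq0 => /eqP.
Qed.

Lemma coord_norm_unit z : size (coord_norm z) = 1 -> exists w, z * w = 1.
Proof.
move=> /eqP /size_poly1P [c c0 Hc]; exists (coord_cst (c^-1)%:P * coord_conj z).
by rewrite mulrCA coord_mul_conj Hc -rmorphM -polyCM mulVf // rmorph1.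
Qed.

(** Infinity is not on the affine curve and receives the unit ideal, the neutral class. *)
Definition point_ideal (P : option (F * F)) : seq R :=
  if P is Some (x0, y0) then [:: coord_cst ('X - x0%:P); coord_y - coord_cst y0%:P]
  else [:: 1].

Definition coord_eval (x0 y0 : F) z := z.1.[x0] + z.2.[x0] * y0.

Lemma point_ideal_eval x0 y0 z : y0 ^+ 2 = f.[x0] ->
  ideal_gen (point_ideal (Some (x0, y0))) z -> coord_eval x0 y0 z = 0.
Proof.
move=> E /= [c [d H]].
have {H}-> : z = d * (coord_y - coord_cst y0%:P) + c * coord_cst ('X - x0%:P).
  by rewrite -(subrK (c * coord_cst ('X - x0%:P)) z); congr (_ + _); apply/eqP; rewrite -subr_eq0 H.
rewrite /coord_eval /= !(hornerE, mulr0, addr0, subr0) /= -E; ring.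
Qed.

(** A generator [g] would divide [x - x0], whose norm has degree 2. Since no norm has degree 1, [g]
    or its cofactor is a unit. In the first case 1 would vanish at the point; in the second [x - x0]
    would divide [y - y0], whose coefficient at [y] is 1. *)
Lemma point_ideal_nonprincipal P : (if P is Some (x0, y0) then y0 ^+ 2 = f.[x0] else True) ->
  ideal_sim (point_ideal P) [:: 1] -> P = None.
Proof.
case: P => [[x0 y0]|//] E [u [v [u0 v0 H]]].
pose gx := coord_cst ('X - x0%:P); pose gy := coord_y - coord_cst y0%:P.
have gen_v z : ideal_gen (ideal_mul [:: v] [:: 1]) z -> exists k, z = v * k.
  by move=> /= [k /eqP]; rewrite mulr1 subr_eq0 => /eqP->; exists k; rewrite mulrC.
have [kx Hx] : exists k, u * gx = v * k.
  by apply/gen_v/H; apply: ideal_gen_mem; rewrite !inE eqxx.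
have [ky Hy] : exists k, u * gy = v * k.
  by apply/gen_v/H; apply: ideal_gen_mem; rewrite !inE eqxx orbT.
have [g Ig Hg] : exists2 g, ideal_gen (point_ideal (Some (x0, y0))) g & v = u * g.
  have : ideal_gen (ideal_mul [:: v] [:: 1]) v by apply: ideal_gen_mem; rewrite !inE mulr1.
  move=> /H /= [c [d /eqP]]; rewrite subr_eq0 => /eqP E1.
  exists (d * gy + c * gx); last first.
    by rewrite mulrDr [u * (d * _)]mulrCA [u * (c * _)]mulrCA -E1 subrK.
  by exists c, d; rewrite /gx /gy addrK subrr.
have {}Hx : gx = g * kx by apply: (coord_mulI u0); rewrite Hx Hg mulrA.
have {}Hy : gy = g * ky by apply: (coord_mulI u0); rewrite Hy Hg mulrA.
have /eqP := coord_normM g kx; rewrite -Hx {1}/coord_norm /= expr0n mul0r subr0 => /eqP HN.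
have X0 : ('X - x0%:P) ^+ 2 != 0 :> {poly F} by rewrite sqrf_eq0 polyXsubC_eq0.
have [Ng0 Nk0] : coord_norm g != 0 /\ coord_norm kx != 0.
  by apply/andP; rewrite -negb_or -mulf_eq0 -HN.
have S : (size (coord_norm g) + size (coord_norm kx)).-1 = 3%N.
  by rewrite -size_mul // -HN expr2 size_mul ?polyXsubC_eq0 // !size_XsubC.
have nz z : coord_norm z != 0 -> z != 0.
  by apply: contra => /eqP->; rewrite /coord_norm /= expr0n mul0r subr0.
have [/eqP a0 /eqP a2] := size_coord_norm (nz _ Ng0).
have [/eqP b0 /eqP b2] := size_coord_norm (nz _ Nk0).
have [/coord_norm_unit [w Hw]|/coord_norm_unit [w Hw]] :
    size (coord_norm g) = 1%N \/ size (coord_norm kx) = 1%N.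
- by move: S a0 a2 b0 b2; lia.
- have /(point_ideal_eval E) : ideal_gen (point_ideal (Some (x0, y0))) 1.
    by rewrite -Hw mulrC; apply: ideal_genM.
  by rewrite /coord_eval /= !hornerE => /eqP; rewrite oner_eq0.
have /(congr1 snd) /(congr1 (horner^~ x0)) : gy = gx * (w * ky).
  by rewrite Hx mulrA -[g * kx * w]mulrA Hw mulr1.
by rewrite /= !hornerE => /eqP; rewrite subrr oppr0 mul0r addr0 oner_eq0.
Qed.

Hypothesis F2 : 2%:R != 0 :> F.
Variables uf vf : {poly F}.
Hypothesis f_sep : uf * f + vf * f^`() = 1.

Lemma coord_half : exists h : R, h * 2%:R = 1.
Proof.
exists (coord_cst (2%:R^-1)%:P).
by rewrite -(rmorph_nat coord_cst) -rmorphM -polyC_natr -polyCM mulVf ?rmorph1.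
Qed.

(** The product is [x - x0] times the ideal [M] generated by [x - x0], [y + y0], [y - y0] and [g],
    where [f = y0^2 + (x - x0) g]. As 2 is invertible, [M] contains [y0], hence [f] and [f'], and
    separability yields 1. *)
Lemma point_ideal_opp x0 y0 : y0 ^+ 2 = f.[x0] ->
  ideal_sim (ideal_mul (point_ideal (Some (x0, y0))) (point_ideal (Some (x0, - y0)))) [:: 1].
Proof.
move=> E; apply: (ideal_sim_trans coord_domain) (principal_sim1 (g := coord_cst ('X - x0%:P)) _).
  apply: ideal_eq_sim; set J := ideal_mul _ _; set gx := coord_cst _.
have [g Hg] : exists g, f = (y0 ^+ 2)%:P + ('X - x0%:P) * g.
  have /factor_theorem [g Hg] : root (f - (y0 ^+ 2)%:P) x0.
    by rewrite /root !hornerE E subrr.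
  by exists g; rewrite mulrC -Hg addrC subrK.
have cy : coord_cst (- y0)%:P = - coord_cst y0%:P by rewrite polyCN rmorphN.
have Y2 : coord_y * coord_y = coord_cst y0%:P ^+ 2 + gx * coord_cst g.
  by rewrite coord_y_sqr -rmorphXn -polyC_exp -rmorphM -rmorphD; apply: (congr1 coord_cst Hg).
have JE : J = [:: gx * gx; gx * (coord_y + coord_cst y0%:P);
               (coord_y - coord_cst y0%:P) * gx; gx * coord_cst g].
  rewrite /J /ideal_mul /= cy opprK; congr [:: _; _; _; _].
  rewrite -[RHS](addKr (coord_cst y0%:P ^+ 2)) -Y2; ring.
apply: ideal_eqP => z.
  have G c : ideal_gen [:: gx] (c * gx) by apply: ideal_genM; apply: ideal_gen_mem; rewrite inE.
  by rewrite JE !inE => /or4P[] /eqP-> //; rewrite mulrC.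
rewrite inE => /eqP->; clear z.
pose M w := ideal_gen J (gx * w).
have MD w t : M w -> M t -> M (w + t) by rewrite /M mulrDr; apply: ideal_genD.
have MM c w : M w -> M (c * w) by rewrite /M mulrCA; apply: ideal_genM.
have MX : M gx by apply: ideal_gen_mem; rewrite JE !inE eqxx.
have M1 : M (coord_y + coord_cst y0%:P) by apply: ideal_gen_mem; rewrite JE !inE eqxx ?orbT.
have M2 : M (coord_y - coord_cst y0%:P).
  by apply: ideal_gen_mem; rewrite JE mulrC !inE eqxx ?orbT.
have M3 : M (coord_cst g) by apply: ideal_gen_mem; rewrite JE !inE eqxx ?orbT.
have [h Hh] := coord_half.
have M4 : M (coord_cst y0%:P).
  have -> : coord_cst y0%:P = h * ((coord_y + coord_cst y0%:P) + (-1) * (coord_y - coord_cst y0%:P)).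
    by rewrite -[LHS]mul1r -[X in X * _ = _]Hh; ring.
  by apply: (MM); apply: (MD) => //; apply: (MM).
suff : M 1 by rewrite /M mulr1.
have -> : 1 = coord_cst (uf * f + vf * f^`()) :> R by rewrite f_sep rmorph1.
rewrite rmorphD !rmorphM /=; apply: (MD); apply: (MM).
  rewrite -coord_y_sqr Y2; apply: (MD); last exact: MM.
  by rewrite expr2; apply: (MM).
have -> : f^`() = g + ('X - x0%:P) * g^`().
  by rewrite [in LHS]Hg derivD derivC add0r derivM derivB derivX derivC subr0 mul1r.
rewrite rmorphD rmorphM /=; by apply: (MD) => //; rewrite mulrC; apply: (MM).
by apply/eqP => /(congr1 fst) /eqP; rewrite /= polyXsubC_eq0.
Qed.

(* Put [p = l X + n] and [L = y - p]; then [L (y + p) = A (x - x1) (x - x2) (x - x3)].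
   The [w] with [L w] in the product of the three ideals form an ideal [M] containing [f];
   as [f] is separable, [f' w] in [M] implies [w] in [M], and this leads to 1. *)
Lemma point_ideal_line (A l n x1 x2 x3 : F) : A != 0 ->
  f = (l *: 'X + n%:P) ^+ 2 + A *: (('X - x1%:P) * ('X - x2%:P) * ('X - x3%:P)) ->
  ideal_sim (ideal_mul (point_ideal (Some (x1, l * x1 + n)))
    (ideal_mul (point_ideal (Some (x2, l * x2 + n))) (point_ideal (Some (x3, l * x3 + n)))))
    [:: 1].
Proof.
move=> A0 Hf; set p := l *: 'X + n%:P in Hf.
pose L := coord_y - coord_cst p; pose L' := coord_y + coord_cst p.
pose X_ x := coord_cst ('X - x%:P).
(* Modulo [X - x] the equation of the line may replace [y - (l x + n)], so the three ideals share
   the generator [L]. *)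
have IE x : ideal_eq (point_ideal (Some (x, l * x + n))) [:: X_ x; L].
  have E : L = coord_y - coord_cst (l * x + n)%:P - coord_cst l%:P * X_ x.
    rewrite /L /X_ /p -rmorphM /= -!addrA -opprD -rmorphD /=; congr (_ - coord_cst _).
     rewrite -mul_polyC polyCD polyCM. ring.
  apply: ideal_eqP => z; rewrite !inE => /orP[] /eqP->; rewrite -?/(X_ x).
  - by apply: ideal_gen_mem; rewrite inE eqxx.
  - rewrite -(subrK (coord_cst l%:P * X_ x) (_ - _)) -E; apply: ideal_genD.
      by apply: ideal_gen_mem; rewrite !inE eqxx orbT.
    by apply: ideal_genM; apply: ideal_gen_mem; rewrite inE eqxx.
  - by apply: ideal_gen_mem; rewrite inE eqxx.
  - rewrite E; apply: ideal_genB.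
      by apply: ideal_gen_mem; rewrite !inE eqxx orbT.
    by apply: ideal_genM; apply: ideal_gen_mem; rewrite inE eqxx.
apply: (ideal_sim_trans coord_domain) (principal_sim1 (g := L) _); last first.
  by apply/eqP => /(congr1 snd) /eqP; rewrite /= subr0 oner_eq0.
apply: ideal_eq_sim.
apply: ideal_eq_trans (ideal_mul_eq (IE _) (ideal_mul_eq (IE _) (IE _))) _.
set J := ideal_mul _ _.
pose k := coord_cst A%:P.
have LL : L * L' = k * (X_ x1 * X_ x2 * X_ x3).
  rewrite /k /X_ -!rmorphM /= mul_polyC /L /L'.
  have -> : A *: (('X - x1%:P) * ('X - x2%:P) * ('X - x3%:P)) = f - p ^+ 2.
    by rewrite [in RHS]Hf [in RHS]addrC addKr.
  by rewrite rmorphB rmorphXn /= -coord_y_sqr; ring.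
have kV : coord_cst (A^-1)%:P * k = 1 by rewrite -rmorphM -polyCM mulVf // rmorph1.
have X3 : X_ x1 * X_ x2 * X_ x3 = coord_cst (A^-1)%:P * (L * L').
  by rewrite LL mulrA kV mul1r.
have JE : J = [:: X_ x1 * (X_ x2 * X_ x3); X_ x1 * (X_ x2 * L); X_ x1 * (L * X_ x3);
  X_ x1 * (L * L); L * (X_ x2 * X_ x3); L * (X_ x2 * L); L * (L * X_ x3); L * (L * L)] by [].
apply: ideal_eqP => z.
  have G c : ideal_gen [:: L] (c * L) by apply: ideal_genM; apply: ideal_gen_mem; rewrite inE.
  rewrite JE !inE.
  case/orP=> [/eqP->|]; first by rewrite mulrA X3 mulrCA mulrC.
  case/orP=> [/eqP->|]; first by rewrite mulrA.
  case/orP=> [/eqP->|]; first by rewrite mulrCA mulrC.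
  case/orP=> [/eqP->|]; first by rewrite mulrA.
  by do 3?[case/orP => [/eqP->|]; first by rewrite mulrC]; move/eqP->; rewrite mulrC.
rewrite inE => /eqP->; clear z.
pose M w := ideal_gen J (L * w).
have MD w t : M w -> M t -> M (w + t) by rewrite /M mulrDr; apply: ideal_genD.
have MM c w : M w -> M (c * w) by rewrite /M mulrCA; apply: ideal_genM.
have ML' : M L'.
  rewrite /M LL -mulrA; apply: ideal_genM; apply: ideal_gen_mem.
  by rewrite JE inE eqxx.
have M12 : M (X_ x1 * X_ x2).
  by rewrite /M (_ : L * _ = X_ x1 * (X_ x2 * L)); [apply: ideal_gen_mem; rewrite JE !inE eqxx ?orbT | ring].
have M13 : M (X_ x1 * X_ x3).
  by rewrite /M (_ : L * _ = X_ x1 * (L * X_ x3)); [apply: ideal_gen_mem; rewrite JE !inE eqxx ?orbT | ring].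
have M23 : M (X_ x2 * X_ x3).
  by rewrite /M; apply: ideal_gen_mem; rewrite JE !inE eqxx ?orbT.
have ML1 : M (L * X_ x1).
  by rewrite /M (_ : L * _ = X_ x1 * (L * L)); [apply: ideal_gen_mem; rewrite JE !inE eqxx ?orbT | ring].
have ML2 : M (L * X_ x2).
  by rewrite /M (_ : L * _ = L * (X_ x2 * L)); [apply: ideal_gen_mem; rewrite JE !inE eqxx ?orbT | ring].
have ML3 : M (L * X_ x3).
  by rewrite /M; apply: ideal_gen_mem; rewrite JE !inE eqxx ?orbT.
have MLL : M (L * L).
  by rewrite /M; apply: ideal_gen_mem; rewrite JE !inE eqxx ?orbT.
have [h Hh] := coord_half.
pose q := coord_cst p.
have qE : q = h * (L' - L).
  by rewrite -[LHS]mul1r -[X in X * _ = _]Hh /L /L' -/q; ring.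
have Mq2 : M (q * q).
  have -> : q * q = h * h * ((L' - 2%:R * L) * L' + L * L) by rewrite qE; ring.
  by apply: (MM); apply: (MD) => //; apply: (MM).
have MqX x : M (L * X_ x) -> M (q * X_ x).
  move=> H; have -> : q * X_ x = h * (X_ x * L' + (-1) * (L * X_ x)) by rewrite qE; ring.
  by apply: (MM); apply: (MD); apply: (MM).
pose cf := coord_cst f; pose cf' := coord_cst f^`().
have cfE : cf = q * q + k * X_ x1 * (X_ x2 * X_ x3).
  rewrite /cf -[RHS]/(_ + _) (congr1 coord_cst Hf) rmorphD rmorphXn expr2; congr (_ + _).
  by rewrite -mul_polyC !rmorphM -/k /= -/(X_ x1) -/(X_ x2) -/(X_ x3) !mulrA.
have cfE' : cf' = k * (X_ x1 * X_ x2 + X_ x1 * X_ x3 + X_ x2 * X_ x3)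
                  + 2%:R * coord_cst l%:P * q.
  have Hf' : f^`() = A%:P * (('X - x1%:P) * ('X - x2%:P) + ('X - x1%:P) * ('X - x3%:P)
                             + ('X - x2%:P) * ('X - x3%:P)) + 2%:R * l%:P * p.
    rewrite [in LHS]Hf expr2 derivD derivZ !derivM !derivB !derivX !derivC !subr0.
    have -> : p^`() = l%:P by rewrite /p derivD derivZ derivX derivC addr0 -mul_polyC mulr1.
    by rewrite -!mul_polyC; ring.
  by rewrite /cf' (congr1 coord_cst Hf') /k /X_ /q /p !(rmorphD, rmorphM, rmorph_nat).
have sepE : 1 = coord_cst uf * cf + coord_cst vf * cf'.
  by rewrite /cf /cf' -!rmorphM -rmorphD f_sep rmorph1.
have Mf : M cf by rewrite cfE; apply: (MD) => //; apply: (MM).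
have Msep w : M (w * cf') -> M w.
  move=> H; have -> : w = coord_cst uf * w * cf + coord_cst vf * (w * cf').
    by rewrite -[LHS]mulr1 sepE; ring.
  by apply: (MD); apply: (MM).
have MX x : M (L * X_ x) -> M (X_ x).
  move=> H; apply: (Msep); rewrite cfE' mulrDr; apply: (MD).
    by rewrite mulrCA; apply: (MM); do 2?[rewrite mulrDr; apply: (MD)]; apply: (MM).
  rewrite (_ : _ * _ = 2%:R * coord_cst l%:P * (q * X_ x)); last by ring.
  by apply: (MM); apply: MqX.
have Mq : M q.
  apply: (Msep); rewrite cfE' mulrDr; apply: (MD).
    by rewrite mulrCA; apply: (MM); do 2?[rewrite mulrDr; apply: (MD)]; apply: (MM).
  rewrite (_ : _ * _ = 2%:R * coord_cst l%:P * (q * q)); last by ring.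
  exact: MM.
suff : M 1 by rewrite /M mulr1.
apply: (Msep); rewrite mul1r cfE'; apply: (MD); last exact: MM.
by apply: (MM); apply: (MD) => //; apply: (MD).
Qed.

End CoordRing.

(** * The group law *)

Section LineAlgebra.
Variable F : fieldType.
Variables (A B C l n x1 x2 x3 : F).

(** The second hypothesis is the divided difference between [x1] and [x2] of
    [(l x + n)^2 = A x^3 + B x^2 + C x + 1]; it also makes sense for tangents. With the sum of the
    roots and one point on the line it fixes the other symmetric functions. *)
Lemma line_coefs :
  A * (x1 + x2 + x3) = l ^+ 2 - B ->
  l * (l * (x1 + x2) + 2%:R * n) = A * (x1 ^+ 2 + x1 * x2 + x2 ^+ 2) + B * (x1 + x2) + C ->
  (l * x1 + n) ^+ 2 = A * x1 ^+ 3 + B * x1 ^+ 2 + C * x1 + 1 ->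
  A * (x1 * x2 + x1 * x3 + x2 * x3) = C - 2%:R * l * n /\ A * (x1 * x2 * x3) = n ^+ 2 - 1.
Proof.
move=> HB HC H1.
have {}HB : B = l ^+ 2 - A * (x1 + x2 + x3) by rewrite HB; ring.
have {}HC : C = l * (l * (x1 + x2) + 2%:R * n) - A * (x1 ^+ 2 + x1 * x2 + x2 ^+ 2) - B * (x1 + x2).
  by rewrite HC; ring.
subst C; subst B; split; first by ring.
have -> : n ^+ 2 - 1 = (l * x1 + n) ^+ 2 - 1 - (l * x1 + n) ^+ 2 + n ^+ 2 by ring.
rewrite {1}H1; ring.
Qed.

Lemma horner_line (f : {poly F}) :
  f = (l *: 'X + n%:P) ^+ 2 + A *: (('X - x1%:P) * ('X - x2%:P) * ('X - x3%:P)) ->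
  f.[x3] = (l * x3 + n) ^+ 2.
Proof.
move->; rewrite hornerD horner_exp hornerD !hornerZ hornerX hornerC !hornerM.
by rewrite !hornerXsubC subrr mulr0 mulr0 addr0.
Qed.

End LineAlgebra.

(** The nondegeneracy is packed with the coefficients so that the type of points can carry a group
    structure without side conditions. *)
Record ec_param := EcParam {
  ec_a : algC; ec_b : algC; ec_c : algC;
  _ : [&& ec_a != 0, ec_b != 0, ec_c != 0, ec_a != ec_b, ec_a != ec_c & ec_b != ec_c] }.

Section GroupLaw.
Variable E : ec_param.
Local Notation a := (ec_a E).
Local Notation b := (ec_b E).
Local Notation c := (ec_c E).
Local Notation A := (a * b * c).
Local Notation B := (a * b + a * c + b * c).
Local Notation C := (a + b + c).

(** Written through its roots, so that separability is the distinctness of [a], [b], [c]. *)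
Definition ec_poly : {poly algC} :=
  A *: \prod_(x <- [:: - a^-1; - b^-1; - c^-1]) ('X - x%:P).

Lemma ec_lead_neq0 : A != 0.
Proof. by case: E => ? ? ? /= /and5P[? ? ? _ _]; rewrite !mulf_neq0. Qed.

Lemma ec_polyE : ec_poly = A%:P * 'X ^+ 3 + B%:P * 'X ^+ 2 + C%:P * 'X + 1%:P.
Proof.
have [a0 b0 c0] : [/\ a != 0, b != 0 & c != 0] by case: E => ? ? ? /= /and5P[? ? ? _ _].
have step (t : algC) : t != 0 -> t%:P * ('X - (- t^-1)%:P) = t%:P * 'X + 1.
  by move=> t0; rewrite polyCN opprK mulrDr -polyCM divff.
rewrite /ec_poly !big_cons big_nil mulr1 -mul_polyC.
rewrite (_ : _ * _ = (a%:P * ('X - (- a^-1)%:P)) * (b%:P * ('X - (- b^-1)%:P)) * (c%:P * ('X - (- c^-1)%:P))).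
  by rewrite !step // !(polyCD, polyCM); ring.
by rewrite !polyCM; ring.
Qed.

Lemma ec_poly_horner x : ec_poly.[x] = A * x ^+ 3 + B * x ^+ 2 + C * x + 1.
Proof. by rewrite ec_polyE !hornerE. Qed.

Lemma size_ec_poly : size ec_poly = 4%N.
Proof. by rewrite size_scale ?ec_lead_neq0 // size_prod_XsubC. Qed.

Lemma ec_poly_sep : exists u v, u * ec_poly + v * ec_poly^`() = 1.
Proof.
have : coprimep ec_poly ec_poly^`().
  rewrite derivZ coprimepZl ?ec_lead_neq0 // coprimepZr ?ec_lead_neq0 //.
  have := separable_prod_XsubC [:: - a^-1; - b^-1; - c^-1].
  rewrite unlock => ->.
  case: E => ? ? ? /= /and5P[_ _ _ ab /andP[ac bc]].
  by rewrite !inE !eqr_opp !(inj_eq invr_inj) negb_or ab ac bc.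
by move/Bezout_eq1_coprimepP => [[u v] H]; exists u, v.
Qed.

(** The group is built on all points over [algC]; rationality over [K] is imposed separately by
    [rational_point]. *)
Definition ec_oncurve (P : ecpoint) : bool :=
  if P is Some (x, y) then y ^+ 2 == A * x ^+ 3 + B * x ^+ 2 + C * x + 1 else true.

Local Notation sim := (@ideal_sim (coord_ring ec_poly)).
Local Notation I_ := (point_ideal ec_poly).
Local Notation "s ** t" := (@ideal_mul (coord_ring ec_poly) s t) (at level 40).

Let dom := @coord_domain _ _ size_ec_poly.
Local Notation strans := (ideal_sim_trans dom).

Lemma ec_two_neq0 : 2%:R != 0 :> algC. Proof. by rewrite pnatr_eq0. Qed.

Definition ec_opp (P : ecpoint) : ecpoint := if P is Some (x, y) then Some (x, - y) else None.

Lemma ec_opp_oncurve P : ec_oncurve P -> ec_oncurve (ec_opp P).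
Proof. by case: P => [[x y]|] //=; rewrite sqrrN. Qed.

Lemma ec_oncurve_poly x y : ec_oncurve (Some (x, y)) -> y ^+ 2 = ec_poly.[x].
Proof. by rewrite /= ec_poly_horner => /eqP. Qed.

Lemma ec_sim_opp P : ec_oncurve P -> sim (I_ P ** I_ (ec_opp P)) [:: 1].
Proof.
case: P => [[x y]|]; last by move=> _; apply: ideal_sim_mul1.
move=> /ec_oncurve_poly H; have [u [v Huv]] := ec_poly_sep.
exact: (point_ideal_opp size_ec_poly ec_two_neq0 Huv H).
Qed.

(** Chord and tangent become one case: both slopes satisfy the divided difference relation of
    [line_coefs], so later arguments use only the line and the Vieta relations. *)
Lemma ec_chord x1 y1 x2 y2 :
  ec_oncurve (Some (x1, y1)) -> ec_oncurve (Some (x2, y2)) ->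
  ~~ ((x1 == x2) && (y1 == - y2)) ->
  exists l n x3, [/\ ec_add a b c (Some (x1, y1)) (Some (x2, y2)) = Some (x3, - (l * x3 + n)),
    y1 = l * x1 + n, y2 = l * x2 + n &
    [/\ A * (x1 + x2 + x3) = l ^+ 2 - B, 
     A * (x1 * x2 + x1 * x3 + x2 * x3) = C - 2%:R * l * n &
     A * (x1 * x2 * x3) = n ^+ 2 - 1]] .
Proof.
move=> /= /eqP H1 /eqP H2 N; rewrite (negbTE N).
set l := (if _ then _ else _); set x3 := _ / _ - _ - _.
exists l, (y1 - l * x1), x3.
have y1E : y1 = l * x1 + (y1 - l * x1) by ring.
have x3E : A * (x1 + x2 + x3) = l ^+ 2 - B.
  by rewrite /x3 [x1 + x2 + _](_ : _ = (l ^+ 2 - B) / A); [rewrite mulrC divfK ?ec_lead_neq0 | ring].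
have [y2E HC] : y2 = l * x2 + (y1 - l * x1) /\
  l * (l * (x1 + x2) + 2%:R * (y1 - l * x1)) =
    A * (x1 ^+ 2 + x1 * x2 + x2 ^+ 2) + B * (x1 + x2) + C.
  move: N; rewrite /l; case: eqVneq => [xx|xx] /= N.
    subst x2; have yy : y2 = y1.
      by move: H2; rewrite -H1 => /eqP; rewrite eqf_sqr => /orP[/eqP->//|/eqP E2]; rewrite E2 opprK eqxx in N.
    subst y2; have y0 : 2%:R * y1 != 0.
      rewrite mulf_neq0 ?ec_two_neq0 //; apply: contra N => /eqP->; by rewrite oppr0.
    split; first by ring.
    set l1 := (X in X * _ = _); transitivity (l1 * (2%:R * y1)); first by ring.
    by rewrite /l1 divfK //; ring.
  have x0 : x2 - x1 != 0 by rewrite subr_eq0 eq_sym.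
  have yE : y2 = (y2 - y1) / (x2 - x1) * x2 + (y1 - (y2 - y1) / (x2 - x1) * x1) by field.
  split => //; apply: (mulIf x0).
  rewrite (_ : _ * _ * (x2 - x1) = y2 ^+ 2 - y1 ^+ 2); last by field.
  by rewrite H1 H2; ring.
by split => //; [congr (Some (_, _)); ring | split => //; have [] // := line_coefs x3E HC _; rewrite -y1E].
Qed.

Lemma ec_line_poly l n x1 x2 x3 :
  A * (x1 + x2 + x3) = l ^+ 2 - B ->
  A * (x1 * x2 + x1 * x3 + x2 * x3) = C - 2%:R * l * n ->
  A * (x1 * x2 * x3) = n ^+ 2 - 1 ->
  ec_poly = (l *: 'X + n%:P) ^+ 2 + A *: (('X - x1%:P) * ('X - x2%:P) * ('X - x3%:P)).
Proof.
move=> H1 H2 H3; rewrite ec_polyE.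
have -> : B = l ^+ 2 - A * (x1 + x2 + x3) by rewrite H1; ring.
have -> : C = 2%:R * l * n + A * (x1 * x2 + x1 * x3 + x2 * x3) by rewrite H2; ring.
have -> : 1%:P = (n ^+ 2 - A * (x1 * x2 * x3))%:P :> {poly algC} by rewrite H3; congr (_%:P); ring.
rewrite -!mul_polyC; move: A => k.
rewrite !expr2 !mulr2n !(polyCD, polyCN, polyCM); ring.
Qed.

(** Let [I3] belong to the third point of the line and [I4] to its opposite, the sum. Then [I1 I2]
    is equivalent to [I1 I2 (I3 I4) = (I1 I2 I3) I4], hence to [I4]. *)
Lemma ec_add_sim P Q : ec_oncurve P -> ec_oncurve Q ->
  ec_oncurve (ec_add a b c P Q) /\ sim (I_ P ** I_ Q) (I_ (ec_add a b c P Q)).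
Proof.
case: P => [[x1 y1]|]; last by move=> _ HQ; split=> //; apply: ideal_sim_mul1.
case: Q => [[x2 y2]|]; last first.
  move=> HP _; split=> //; apply: strans (ideal_sim_mulC _ _) _; exact: ideal_sim_mul1.
have [/andP[/eqP-> /eqP->]|N] := boolP ((x1 == x2) && (y1 == - y2)).
  move=> HP HQ; have -> : ec_add a b c (Some (x2, - y2)) (Some (x2, y2)) = None.
    by rewrite /ec_add !eqxx.
  split=> //; apply: strans (ideal_sim_mulC _ _) _; exact: (ec_sim_opp HQ).
move=> HP HQ; have [l [n [x3 [-> y1E y2E [H1 H2 H3]]]]] := ec_chord HP HQ N.
have Hf := ec_line_poly H1 H2 H3.
have HR : ec_oncurve (Some (x3, l * x3 + n)).
  by rewrite /= -ec_poly_horner (horner_line Hf).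
split; first exact: (ec_opp_oncurve HR).
have [u [v Huv]] := ec_poly_sep.
have := point_ideal_line size_ec_poly ec_two_neq0 Huv ec_lead_neq0 Hf.
rewrite -y1E -y2E; set I1 := I_ _; set I2 := I_ _; set I3 := I_ _ => line.
have opp := ec_sim_opp HR; rewrite -/I3 /= in opp; set I4 := I_ _ in opp *.
apply: strans (ideal_sim_sym (ideal_sim_mul1 _)) _.
apply: strans (ideal_mul_sim dom (ideal_sim_sym opp) (ideal_sim_refl _)) _.
apply: strans (ideal_mul_sim dom (ideal_sim_mulC _ _) (ideal_sim_refl _)) _.
apply: strans (ideal_sim_sym (ideal_sim_mulA _ _ _)) _.
apply: strans (ideal_sim_mulC _ _) _.
apply: strans (ideal_mul_sim dom (ideal_sim_mulC _ _) (ideal_sim_refl _)) _.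
apply: strans (ideal_mul_sim dom (ideal_sim_sym (ideal_sim_mulA _ _ _)) (ideal_sim_refl _)) _.
exact: strans (ideal_mul_sim dom line (ideal_sim_refl _)) (ideal_sim_mul1 _).
Qed.

Lemma ec_add_opp_None P Q : ec_add a b c P (ec_opp Q) = None -> P = Q.
Proof.
case: P Q => [[x1 y1]|] [[x2 y2]|] //=; rewrite opprK.
by case: ifP => // /andP[/eqP-> /eqP->].
Qed.

(** [P - Q] has trivial class, so it is infinity by [point_ideal_nonprincipal]. Associativity and
    commutativity are pulled back along this injection. *)
Lemma point_ideal_inj P Q : ec_oncurve P -> ec_oncurve Q -> sim (I_ P) (I_ Q) -> P = Q.
Proof.
move=> HP HQ PQ; apply: ec_add_opp_None.
have [oc s1] := ec_add_sim HP (ec_opp_oncurve HQ).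
apply: (point_ideal_nonprincipal size_ec_poly (P := ec_add a b c P (ec_opp Q))).
  by move: oc; case: (ec_add _ _ _ _ _) => [[x y]|] // /ec_oncurve_poly.
apply: strans (ideal_sim_sym s1) _.
exact: strans (ideal_mul_sim dom PQ (ideal_sim_refl _)) (ec_sim_opp HQ).
Qed.

Record ec_point := EcPoint { ec_val :> ecpoint; ec_valP : ec_oncurve ec_val }.
HB.instance Definition _ := [isSub for ec_val].
HB.instance Definition _ := [Choice of ec_point by <:].

Definition ec_point_add (P Q : ec_point) :=
  EcPoint (ec_add_sim (ec_valP P) (ec_valP Q)).1.
Definition ec_point_opp (P : ec_point) := EcPoint (ec_opp_oncurve (ec_valP P)).
Definition ec_point0 := @EcPoint None isT.

Fact ec_point_addA : associative ec_point_add.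
Proof.
move=> P Q S; apply: val_inj; apply: point_ideal_inj; try exact: ec_valP.
have s (P' Q' : ec_point) : sim (I_ (ec_val P') ** I_ (ec_val Q')) (I_ (ec_val (ec_point_add P' Q'))).
  exact: (ec_add_sim (ec_valP P') (ec_valP Q')).2.
apply: strans (ideal_sim_sym (s _ _)) _.
apply: strans (ideal_mul_sim dom (ideal_sim_refl _) (ideal_sim_sym (s _ _))) _.
apply: strans (ideal_sim_mulA _ _ _) _.
exact: strans (ideal_mul_sim dom (s _ _) (ideal_sim_refl _)) (s _ _).
Qed.

Fact ec_point_addC : commutative ec_point_add.
Proof.
move=> P Q; apply: val_inj; apply: point_ideal_inj; try exact: ec_valP.
have s (P' Q' : ec_point) : sim (I_ (ec_val P') ** I_ (ec_val Q')) (I_ (ec_val (ec_point_add P' Q'))).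
  exact: (ec_add_sim (ec_valP P') (ec_valP Q')).2.
exact: strans (ideal_sim_sym (s _ _)) (strans (ideal_sim_mulC _ _) (s _ _)).
Qed.

Fact ec_point_add0 : left_id ec_point0 ec_point_add.
Proof. by move=> P; apply: val_inj. Qed.

Fact ec_point_addN : left_inverse ec_point0 ec_point_opp ec_point_add.
Proof. by move=> [[[x y]|] P]; apply: val_inj; rewrite //= !eqxx. Qed.

HB.instance Definition _ := GRing.isZmodule.Build ec_point
  ec_point_addA ec_point_addC ec_point_add0 ec_point_addN.

Lemma ec_val_add (P Q : ec_point) : ec_val (P + Q) = ec_add a b c P Q.
Proof. by []. Qed.

Lemma ec_val_muln n (P : ec_point) : ec_val (P *+ n) = ec_mul a b c n P.
Proof. by elim: n => [|n IH] //; rewrite mulrS ec_val_add IH. Qed.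

End GroupLaw.

(** * Torsion and reduction *)

(* [pl_res] is meaningful on [pl_int] only; [pl_unram] says that [p] is a uniformizer. *)
Record place (K : algC -> Prop) (p : nat) := Place {
  pl_int : algC -> Prop;
  pl_res : algC -> 'F_p;
  pl_int1 : pl_int 1;
  pl_intB : forall x y, pl_int x -> pl_int y -> pl_int (x - y);
  pl_intM : forall x y, pl_int x -> pl_int y -> pl_int (x * y);
  pl_res1 : pl_res 1 = 1;
  pl_resB : forall x y, pl_int x -> pl_int y -> pl_res (x - y) = pl_res x - pl_res y;
  pl_resM : forall x y, pl_int x -> pl_int y -> pl_res (x * y) = pl_res x * pl_res y;
  pl_intV : forall x, pl_int x -> pl_res x != 0 -> pl_int x^-1;
  pl_val : forall x, K x -> pl_int x \/ pl_int x^-1;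
  pl_unram : forall x, pl_int x -> pl_res x = 0 -> exists2 y, pl_int y & x = p%:R * y }.

Section SubfieldClosure.
Variables (K : algC -> Prop) (Ksub : is_subfield K).

Lemma subfield0 : K 0. Proof. by case: Ksub. Qed.
Lemma subfield1 : K 1. Proof. by case: Ksub. Qed.
Lemma subfieldB x y : K x -> K y -> K (x - y). Proof. by case: Ksub => _ _ H _ _; apply: H. Qed.
Lemma subfieldN x : K x -> K (- x).
Proof. by move=> ?; rewrite -sub0r; apply: subfieldB => //; apply: subfield0. Qed.
Lemma subfieldD x y : K x -> K y -> K (x + y).
Proof. by move=> hx hy; rewrite -[y]opprK; apply: subfieldB => //; apply: subfieldN. Qed.
Lemma subfieldM x y : K x -> K y -> K (x * y). Proof. by case: Ksub => _ _ _ H _; apply: H. Qed.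
Lemma subfieldV x : K x -> K x^-1.
Proof.
have [->|x0] := eqVneq x 0; first by rewrite invr0.
by case: Ksub => _ _ _ _ H /H; apply.
Qed.
Lemma subfieldX x n : K x -> K (x ^+ n).
Proof.
by move=> hx; elim: n => [|n IH]; [apply: subfield1 | rewrite exprS; apply: subfieldM].
Qed.
Lemma subfield_nat n : K n%:R.
Proof.
elim: n => [|n IH]; first exact: subfield0.
by rewrite -(addn1 n) natrD; apply: subfieldD => //; apply: subfield1.
Qed.

Definition rational_point (P : ecpoint) := if P is Some (x, y) then K x /\ K y else True.

Lemma ec_add_rational a b c P Q : K a -> K b -> K c ->
  rational_point P -> rational_point Q -> rational_point (ec_add a b c P Q).
Proof.
move=> Ka Kb Kc; case: P => [[x1 y1]|] // [? ?]; case: Q => [[x2 y2]|] // [? ?] /=.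
case: ifP => // _ /=.
set l := (if _ then _ else _).
have Kl : K l.
  by rewrite /l; case: ifP => _; repeat first
    [assumption | apply: subfield_nat | apply: subfieldX | apply: subfieldD | apply: subfieldB |
     apply: subfieldN | apply: subfieldM | apply: subfieldV ].
by split; repeat first
    [assumption | apply: subfield_nat | apply: subfieldX | apply: subfieldB | apply: subfieldN |
     apply: subfieldD | apply: subfieldM | apply: subfieldV ].
Qed.

End SubfieldClosure.

Section PlaceTheory.
Variables (K : algC -> Prop) (p : nat) (pl : place K p).
Hypothesis p_prime : prime p.
Local Notation O := (pl_int pl).
Local Notation res := (pl_res pl).

Lemma pl_int0 : O 0. Proof. by rewrite -(subrr 1); apply: pl_intB; apply: pl_int1. Qed.
Lemma pl_res0 : res 0 = 0.
Proof. by rewrite -(subrr 1) pl_resB ?subrr //; apply: pl_int1. Qed.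
Lemma pl_intN x : O x -> O (- x).
Proof. by move=> hx; rewrite -sub0r; apply: pl_intB => //; apply: pl_int0. Qed.
Lemma pl_resN x : O x -> res (- x) = - res x.
Proof. by move=> hx; rewrite -sub0r pl_resB ?pl_res0 ?sub0r //; apply: pl_int0. Qed.
Lemma pl_intD x y : O x -> O y -> O (x + y).
Proof. by move=> hx hy; rewrite -[y]opprK; apply: pl_intB => //; apply: pl_intN. Qed.
Lemma pl_resD x y : O x -> O y -> res (x + y) = res x + res y.
Proof.
by move=> hx hy; rewrite -{1}[y]opprK pl_resB ?pl_resN ?opprK //; apply: pl_intN.
Qed.
Lemma pl_int_nat n : O n%:R.
Proof.
elim: n => [|n IH]; first exact: pl_int0.
by rewrite -(addn1 n) natrD; apply: pl_intD => //; apply: pl_int1.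
Qed.
Lemma pl_res_nat n : res n%:R = n%:R.
Proof.
elim: n => [|n IH]; first exact: pl_res0.
rewrite -(addn1 n) !natrD pl_resD ?IH ?pl_res1 //; [exact: pl_int_nat | exact: pl_int1].
Qed.
Lemma pl_intX x n : O x -> O (x ^+ n).
Proof. by move=> hx; elim: n => [|n IH]; [apply: pl_int1 | rewrite exprS; apply: pl_intM]. Qed.
Lemma pl_resX x n : O x -> res (x ^+ n) = res x ^+ n.
Proof.
move=> hx; elim: n => [|n IH]; first exact: pl_res1.
by rewrite !exprS pl_resM ?IH //; apply: pl_intX.
Qed.
Lemma pl_resV x : O x -> res x != 0 -> res x^-1 = (res x)^-1.
Proof.
move=> hx rx; have x0 : x != 0 by apply: contra rx => /eqP->; rewrite pl_res0.
apply: (mulfI rx); rewrite -pl_resM ?divff ?pl_res1 //; exact: pl_intV.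
Qed.

(** An instance of the integral closedness of valuation rings; it yields integral [y] from integral
    [x], and integral slopes. *)
Lemma pl_int_sqr x : K x -> O (x ^+ 2) -> O x.
Proof.
move=> /(pl_val pl) [//|hV] h2; have [->|x0] := eqVneq x 0; first exact: pl_int0.
have -> : x = x ^+ 2 * x^-1 by rewrite expr2 mulfK.
exact: pl_intM.
Qed.

Lemma pl_int_dec x : K x -> O x \/ ~ O x.
Proof.
move=> /(pl_val pl) [hx|hV]; first by left.
have [rV|/(pl_intV hV)] := eqVneq (res x^-1) 0; last by rewrite invrK; left.
have [->|x0] := eqVneq x 0; first by left; apply: pl_int0.
right=> hx; have := pl_resM hx hV.
by rewrite divff // pl_res1 rV mulr0 => /eqP; rewrite oner_eq0.
Qed.

(** Divisibility replaces inequalities between valuations, so no valuation function has to be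
    defined. *)
Definition pl_dvd (t x : algC) := exists2 y, O y & x = t * y.

Lemma pl_dvdD t x y : pl_dvd t x -> pl_dvd t y -> pl_dvd t (x + y).
Proof. by move=> [u hu ->] [v hv ->]; exists (u + v); [apply: pl_intD | rewrite mulrDr]. Qed.
Lemma pl_dvdN t x : pl_dvd t x -> pl_dvd t (- x).
Proof. by move=> [u hu ->]; exists (- u); [apply: pl_intN | rewrite mulrN]. Qed.
Lemma pl_dvdB t x y : pl_dvd t x -> pl_dvd t y -> pl_dvd t (x - y).
Proof. by move=> hx hy; apply: pl_dvdD => //; apply: pl_dvdN. Qed.
Lemma pl_dvdM t x u y : pl_dvd t x -> pl_dvd u y -> pl_dvd (t * u) (x * y).
Proof. by move=> [v hv ->] [w hw ->]; exists (v * w); [apply: pl_intM | rewrite mulrACA]. Qed.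
Lemma pl_dvdMl t x y : O x -> pl_dvd t y -> pl_dvd t (x * y).
Proof. by move=> hx [w hw ->]; exists (x * w); [apply: pl_intM | rewrite mulrCA]. Qed.
Lemma pl_dvd_int t x : O t -> pl_dvd t x -> O x.
Proof. by move=> ht [w hw ->]; apply: pl_intM. Qed.
Lemma pl_dvd_res t x : O t -> res t = 0 -> pl_dvd t x -> res x = 0.
Proof. by move=> ht rt [w hw ->]; rewrite pl_resM // rt mul0r. Qed.
Lemma pl_dvd_trans u t x : pl_dvd t u -> pl_dvd u x -> pl_dvd t x.
Proof. by move=> [v hv ->] [w hw ->]; exists (v * w); [apply: pl_intM | rewrite mulrA]. Qed.
Lemma pl_dvd0 t : pl_dvd t 0.
Proof. by exists 0; [apply: pl_int0 | rewrite mulr0]. Qed.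
Lemma pl_dvd_refl t : pl_dvd t t.
Proof. by exists 1; [apply: pl_int1 | rewrite mulr1]. Qed.

(** * The kernel of reduction and the integrality of torsion points *)

Section Kernel.
Variable E : ec_param.
Hypothesis Ksub : is_subfield K.
Local Notation a := (ec_a E).
Local Notation b := (ec_b E).
Local Notation c := (ec_c E).
Local Notation A := (a * b * c).
Local Notation B := (a * b + a * c + b * c).
Local Notation C := (a + b + c).
Hypotheses (Ka : K a) (Kb : K b) (Kc : K c) (Oa : O a) (Ob : O b) (Oc : O c).
Hypothesis Ares : [&& res a != 0, res b != 0 & res c != 0].

Lemma int_A : O A. Proof. by do 2?apply: pl_intM. Qed.
Lemma int_B : O B. Proof. by do 2?apply: pl_intD; apply: pl_intM. Qed.
Lemma int_C : O C. Proof. by do 2?apply: pl_intD. Qed.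
Lemma res_A_neq0 : res A != 0.
Proof.
by case/and3P: Ares => ra rb rc; rewrite !pl_resM ?mulf_neq0 //; apply: pl_intM.
Qed.

(** The local parameter at infinity. *)
Definition tpar (P : ecpoint) := if P is Some (x, y) then x / y else 0.

(** A level of the formal group filtration: near infinity [1 / y] has three times the order of
    [x / y], which explains the cube. *)
Definition in_kernel (t : algC) (P : ecpoint) :=
  if P is Some (x, y) then [/\ y != 0, pl_dvd t (x / y) & pl_dvd (t ^+ 3) y^-1] else True.

(* Divided difference of [s = A t^3 + B t^2 s + C t s^2 + s^3], where [t = x / y] and
   [s = 1 / y], between two points of the line [y = l x + n]; it also covers tangents. *)
Lemma chord_slope_ts (A' B' C' l n x1 x2 x3 y1 y2 : algC) :
  A' * (x1 + x2 + x3) = l ^+ 2 - B' ->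
  A' * (x1 * x2 + x1 * x3 + x2 * x3) = C' - 2%:R * l * n ->
  A' * (x1 * x2 * x3) = n ^+ 2 - 1 ->
  y1 = l * x1 + n -> y2 = l * x2 + n -> y1 != 0 -> y2 != 0 ->
  let t1 := x1 / y1 in let t2 := x2 / y2 in let s1 := y1^-1 in let s2 := y2^-1 in
  n * (A' * (t1 ^+ 2 + t1 * t2 + t2 ^+ 2) + B' * ((t1 + t2) * s1) + C' * s1 ^+ 2) +
  l * (1 - (B' * t2 ^+ 2 + C' * (t2 * (s1 + s2)) + (s1 ^+ 2 + s1 * s2 + s2 ^+ 2))) = 0.
Proof.
move=> H1 H2 H3 Y1 Y2 y10 y20 /=.
have E1 : 1 = n ^+ 2 - A' * (x1 * x2 * x3) by rewrite H3; ring.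
have EB : B' = l ^+ 2 - A' * (x1 + x2 + x3) by rewrite H1; ring.
have EC : C' = 2%:R * l * n + A' * (x1 * x2 + x1 * x3 + x2 * x3) by rewrite H2; ring.
have : n * (A' * (x1 ^+ 2 * y2 ^+ 2 + x1 * x2 * y1 * y2 + x2 ^+ 2 * y1 ^+ 2) +
         B' * (x1 * y2 + x2 * y1) * y2 + C' * y2 ^+ 2) +
    l * (y1 ^+ 2 * y2 ^+ 2 - B' * x2 ^+ 2 * y1 ^+ 2 - C' * x2 * y1 * (y1 + y2) -
         1 * (y1 ^+ 2 + y1 * y2 + y2 ^+ 2)) = 0.
  rewrite E1 EB EC Y1 Y2; ring.
move=> T; apply: (mulIf (x := y1 ^+ 2 * y2 ^+ 2)); first by rewrite mulf_neq0 // sqrf_eq0.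
by rewrite mul0r -[RHS]T; field; rewrite y10 y20.
Qed.

(** In the coordinates [x / y] and [1 / y] the line has slope divisible by [t^2] and intercept [nu]
    divisible by [t^3]. The sum of the three parameters on it is an integral multiple of [nu], so
    addition is additive on parameters modulo [t^3]. *)
Lemma in_kernel_add t P Q : O t -> res t = 0 ->
  ec_oncurve E P -> ec_oncurve E Q -> in_kernel t P -> in_kernel t Q ->
  in_kernel t (ec_add a b c P Q) /\
  pl_dvd (t ^+ 3) (tpar (ec_add a b c P Q) - tpar P - tpar Q).
Proof.
move=> Ot rt; case: P => [[x1 y1]|] oc1; last first.
  by move=> _ _ HQ; split=> //; rewrite subr0 subrr; apply: pl_dvd0.
case: Q => [[x2 y2]|] oc2; last first.
  by move=> HP _; split=> //=; rewrite subrr sub0r oppr0; apply: pl_dvd0.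
move=> [y10 dt1 ds1] [y20 dt2 ds2].
have [/andP[/eqP xx /eqP yy]|N] := boolP ((x1 == x2) && (y1 == - y2)).
  rewrite /= xx yy !eqxx /=; split=> //.
  by rewrite sub0r invrN mulrN opprK subrr; apply: pl_dvd0.
have [l [n [x3 [-> Y1 Y2 [H1 H2 H3]]]]] := ec_chord oc1 oc2 N.
have := chord_slope_ts H1 H2 H3 Y1 Y2 y10 y20.
set t1 := x1 / y1 in dt1 *; set t2 := x2 / y2 in dt2 *.
set s1 := y1^-1 in ds1 *; set s2 := y2^-1 in ds2 * => /=.
set num := (X in n * X); set w := (X in 1 - X) => T.
have Ot2 : O (t ^+ 2) by apply: pl_intX.
have Ot3 : O (t ^+ 3) by apply: pl_intX.
have d3 x : pl_dvd (t ^+ 3) x -> pl_dvd t x.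
  by apply: pl_dvd_trans; rewrite exprS mulrC; apply: pl_dvdMl => //; apply: pl_dvd_refl.
have tt x y : pl_dvd t x -> pl_dvd t y -> pl_dvd (t ^+ 2) (x * y) by apply: pl_dvdM.
have Ot1 : O t1 := pl_dvd_int Ot dt1.
have OA := int_A; have OB := int_B; have OC := int_C.
have dnum : pl_dvd (t ^+ 2) num.
  apply: pl_dvdD; [apply: pl_dvdD|]; apply: pl_dvdMl => //.
  - by apply: pl_dvdD; [apply: pl_dvdD|]; rewrite ?expr2; apply: tt.
  - by apply: tt; [apply: pl_dvdD | apply: d3].
  - by rewrite [s1 ^+ 2]expr2; apply: tt; apply: d3.
have dw : pl_dvd (t ^+ 2) w.
  apply: pl_dvdD; [apply: pl_dvdD; apply: pl_dvdMl => //|].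
  - by rewrite [t2 ^+ 2]expr2; apply: tt.
  - by apply: tt => //; apply: pl_dvdD; apply: d3.
  - by rewrite !expr2; apply: pl_dvdD; [apply: pl_dvdD|]; apply: tt; apply: d3.
have rt2 : res (t ^+ 2) = 0 by rewrite pl_resX // rt expr0n.
have Ow := pl_dvd_int Ot2 dw; have rw := pl_dvd_res Ot2 rt2 dw.
have Oden : O (1 - w) by apply: pl_intB => //; apply: pl_int1.
have rden : res (1 - w) != 0 by rewrite pl_resB ?pl_res1 ?rw ?subr0 ?oner_neq0 //; apply: pl_int1.
have den0 : 1 - w != 0 by apply: contra rden => /eqP->; rewrite pl_res0.
have n0 : n != 0.
  apply/eqP => n0; move/eqP: T; rewrite n0 mul0r add0r mulf_eq0 (negbTE den0) orbF => /eqP l0.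
  by move: y10; rewrite Y1 l0 n0 mul0r addr0 eqxx.
(* Dividing [y = l x + n] by [n y] gives [s = lam t + nu] for [t = x / y] and [s = 1 / y]. *)
pose lam := - l / n; pose nu := n^-1.
have lamE : lam = num * (1 - w)^-1.
  apply: (mulIf (mulf_neq0 n0 den0)); rewrite /lam [RHS]mulrA.
  have -> : - l / n * (n * (1 - w)) = - (l * (1 - w)) by field.
  have -> : num * (1 - w)^-1 * n * (1 - w) = n * num by field.
  by apply/eqP; rewrite eqr_oppLR -addr_eq0 addrC T.
have dlam : pl_dvd (t ^+ 2) lam.
  by rewrite lamE mulrC; apply: pl_dvdMl => //; apply: pl_intV.
have nuE : nu = s1 - lam * t1.
  rewrite /nu /lam /s1 /t1 (_ : _ - _ = (l * x1 + n) / (n * y1)); last by field; rewrite n0 y10.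
  by rewrite -Y1; field; rewrite n0 y10.
have dnu : pl_dvd (t ^+ 3) nu.
  by rewrite nuE; apply: pl_dvdB => //; rewrite exprSr; apply: pl_dvdM.
have Olam := pl_dvd_int Ot2 dlam; have rlam := pl_dvd_res Ot2 rt2 dlam.
pose D := A + lam * (B + C * lam + lam ^+ 2).
have OD' : O (B + C * lam + lam ^+ 2).
  by do 2?[apply: pl_intD => //]; [apply: pl_intM | apply: pl_intX].
have OD : O D by apply: pl_intD => //; apply: pl_intM.
have rD : res D != 0.
  rewrite /D pl_resD //; last exact: pl_intM.
  by rewrite [res (lam * _)]pl_resM // rlam mul0r addr0; exact: res_A_neq0.
have D0 : D != 0 by apply: contra rD => /eqP->; rewrite pl_res0.
have E1 : 1 = n ^+ 2 - A * (x1 * x2 * x3) by rewrite H3; ring.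
have EB : B = l ^+ 2 - A * (x1 + x2 + x3) by rewrite H1; ring.
have EC : C = 2%:R * l * n + A * (x1 * x2 + x1 * x3 + x2 * x3) by rewrite H2; ring.
pose y3 := l * x3 + n.
(* As [n] and [D] are nonzero, this excludes [y3 = 0]: the third point has finite coordinates
   [(t, s)]. *)
have DE : A * (y1 * y2 * y3) = n ^+ 3 * D.
  rewrite /D /lam EB EC Y1 Y2 /y3; move: A => k in E1 *.
  have -> : n ^+ 3 * (k + - l / n * (l ^+ 2 - k * (x1 + x2 + x3) +
      (2%:R * l * n + k * (x1 * x2 + x1 * x3 + x2 * x3)) * (- l / n) + (- l / n) ^+ 2)) =
    n ^+ 3 * k - l * n ^+ 2 * (l ^+ 2 - k * (x1 + x2 + x3)) +
    l ^+ 2 * n * (2%:R * l * n + k * (x1 * x2 + x1 * x3 + x2 * x3)) -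
    l ^+ 3 * (n ^+ 2 - k * (x1 * x2 * x3)) by rewrite -E1; field.
  by ring.
have y30 : y3 != 0.
  apply/eqP => y30; move: DE; rewrite y30 !mulr0 => /eqP.
  by rewrite eq_sym mulf_eq0 expf_eq0 /= (negbTE n0) (negbTE D0).
pose t3 := x3 / y3.
(* Vieta for the cubic in [t] obtained by substituting [s = lam t + nu]: its leading coefficient is
   [D], and the numerator is its coefficient at [t^2]. *)
have sumE : t1 + t2 + t3 = - ((3%:R * lam ^+ 2 + 2%:R * lam * C + B) * nu / D).
  have -> : t1 + t2 + t3 = A * (x1 * y2 * y3 + x2 * y1 * y3 + x3 * y1 * y2) / (n ^+ 3 * D).
    rewrite -DE /t1 /t2 /t3; have := ec_lead_neq0 E; move: A => k k0.
    by field; rewrite ?y10 ?y20 ?y30 ?k0.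
  apply: (mulIf (mulf_neq0 (expf_neq0 3 n0) D0)); rewrite divfK ?mulf_neq0 ?expf_neq0 //.
  have -> : - ((3%:R * lam ^+ 2 + 2%:R * lam * C + B) * nu / D) * (n ^+ 3 * D) =
      - (3%:R * l ^+ 2 * (n ^+ 2 - A * (x1 * x2 * x3)) - 2%:R * l * n * C + n ^+ 2 * B).
    by rewrite -E1 /lam /nu; move: A B C => k k' k'' in D0 *; field; rewrite n0 D0.
  by rewrite EB EC Y1 Y2 /y3; move: A => k; ring.
have dsum : pl_dvd (t ^+ 3) (t1 + t2 + t3).
  rewrite sumE; apply: pl_dvdN; rewrite mulrAC; apply: pl_dvdMl => //.
  apply: pl_intM; last exact: pl_intV.
  apply: pl_intD => //; apply: pl_intD; repeat first
    [assumption | apply: pl_int_nat | apply: pl_intX | apply: pl_intM].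
have dt3 : pl_dvd t t3.
  have -> : t3 = (t1 + t2 + t3) - t1 - t2 by ring.
  by do 2?apply: pl_dvdB => //; apply: d3.
have ds3 : pl_dvd (t ^+ 3) y3^-1.
  have -> : y3^-1 = lam * t3 + nu.
    rewrite /lam /nu /t3 (_ : _ + _ = (y3 - l * x3) / (n * y3)); last by field; rewrite n0 y30.
    by rewrite (_ : y3 - l * x3 = n); [field; rewrite n0 y30 | rewrite /y3; ring].
  by apply: pl_dvdD => //; rewrite exprSr; apply: pl_dvdM.
rewrite -/y3 /= !invrN !mulrN oppr_eq0; split; first by split=> //; apply: pl_dvdN.
by rewrite (_ : _ - _ = - (t1 + t2 + t3)); [apply: pl_dvdN | rewrite /t1 /t2 /t3; ring].
Qed.

Lemma ec_rational_muln n (P : ec_point E) :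
  rational_point K (ec_val P) -> rational_point K (ec_val (P *+ n)).
Proof.
move=> HP; elim: n => [|n IH] //; rewrite mulrS ec_val_add; exact: ec_add_rational.
Qed.

Lemma in_kernel_muln t (P : ec_point E) n : O t -> res t = 0 -> in_kernel t (ec_val P) ->
  in_kernel t (ec_val (P *+ n)) /\
  pl_dvd (t ^+ 3) (tpar (ec_val (P *+ n)) - n%:R * tpar (ec_val P)).
Proof.
move=> Ot rt HP; elim: n => [|n [IH1 IH2]].
  by split=> //=; rewrite mul0r subrr; apply: pl_dvd0.
rewrite mulrS ec_val_add.
have [H1 H2] := in_kernel_add Ot rt (ec_valP P) (ec_valP _) HP IH1; split=> //.
rewrite (_ : _ - _ = (tpar (ec_add a b c (ec_val P) (ec_val (P *+ n))) - tpar (ec_val P)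
    - tpar (ec_val (P *+ n))) + (tpar (ec_val (P *+ n)) - n%:R * tpar (ec_val P))).
  exact: pl_dvdD.
by rewrite -addn1 natrD; ring.
Qed.

(** [y^2 = x^3 V] with [V] a unit, so [t^2 = 1 / (x V)] and [1 / y = V t^3]. The point lies at the
    level of its own parameter, which makes the later comparison of [l t] with [t^3] conclusive. *)
Lemma nonint_in_kernel x y : ec_oncurve E (Some (x, y)) -> K x -> K y -> ~ O x ->
  let t := x / y in [/\ O t, res t = 0, t != 0 & in_kernel t (Some (x, y))].
Proof.
move=> /eqP oc Kx Ky NOx /=.
have Oxi : O x^-1 by case: (pl_val pl Kx).
have x0 : x != 0 by apply/eqP => x0; apply: NOx; rewrite x0; apply: pl_int0.
have rxi : res x^-1 = 0.
  apply/eqP; apply: contraT => /(pl_intV Oxi); rewrite invrK => /NOx [].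
pose V := A + x^-1 * (B + C * x^-1 + x^-1 ^+ 2).
have OV' : O (B + C * x^-1 + x^-1 ^+ 2).
  apply: pl_intD; last exact: pl_intX.
  by apply: pl_intD; [exact: int_B | apply: pl_intM => //; exact: int_C].
have OV : O V by apply: pl_intD; [exact: int_A | apply: pl_intM].
have rV : res V != 0.
  rewrite /V pl_resD; [|exact: int_A|exact: pl_intM].
  by rewrite [res (x^-1 * _)]pl_resM // rxi mul0r addr0; exact: res_A_neq0.
have V0 : V != 0 by apply: contra rV => /eqP->; rewrite pl_res0.
have y2 : y ^+ 2 = x ^+ 3 * V.
  by rewrite oc /V; move: A B C => k k' k''; field; rewrite x0.
have y0 : y != 0 by rewrite -sqrf_eq0 y2 mulf_neq0 // expf_neq0.
set t := x / y.
have t2 : t ^+ 2 = x^-1 * V^-1.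
  by rewrite /t expr_div_n y2; field; rewrite x0 V0.
have OVi : O V^-1 by apply: pl_intV.
have Ot : O t by apply: pl_int_sqr; [apply: subfieldM => //; exact: subfieldV | rewrite t2; apply: pl_intM].
have rt : res t = 0.
  by apply/eqP; rewrite -sqrf_eq0 -pl_resX // t2 pl_resM // rxi mul0r.
have t0 : t != 0 by rewrite mulf_neq0 ?invr_eq0.
split=> //; split=> //; first by exact: pl_dvd_refl.
exists V => //; rewrite exprS t2 /t; field; by rewrite ?x0 ?y0 ?V0.
Qed.

Hypothesis p_odd : p != 2%N.

Lemma res_prime_neq0 l : prime l -> l != p -> (l%:R : 'F_p) != 0.
Proof.
move=> lp; apply: contra => /eqP H; have : p \in [pchar 'F_p] by apply: pchar_Fp.
by move/dvdn_pcharf => /(_ l); rewrite H eqxx dvdn_prime2 // eq_sym => ->.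
Qed.

(* On the kernel of reduction [x / y] is additive modulo cubes.  For a point of prime
   order [l] in this kernel, [l] is therefore a multiple of [(x / y)^2]; this is
   impossible, also for [l = p], since [x / y] is divisible by [p]. *)
Lemma torsion_integral (P : ec_point E) n : (0 < n)%N -> P *+ n = 0 ->
  rational_point K (ec_val P) -> if ec_val P is Some (x, y) then O x /\ O y else True.
Proof.
move=> n0 Pn; case EP : (ec_val P) => [[x y]|] // [Kx Ky].
have oc : ec_oncurve E (Some (x, y)) by rewrite -EP ec_valP.
have Ox : O x -> O y.
  move=> Ox; apply: pl_int_sqr => //; move/eqP: oc => ->.
  repeat first [assumption | exact: pl_int1 | apply: pl_intD | apply: pl_intM | apply: pl_intX].
have [HO|NO] := pl_int_dec Kx; first by split; auto.
exfalso.
(* With [m] minimal and [l] a prime factor of [m], the multiple [Q = (m / l) P] is nonzero and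
   killed by [l]. *)
have ex_n : exists n, (0 < n)%N && (P *+ n == 0) by exists n; rewrite n0 Pn eqxx.
case: (ex_minnP ex_n) => m /andP[m0 /eqP Pm] m_min.
have m1 : (1 < m)%N.
  case: m m0 Pm m_min => [|[|m]] // _; rewrite mulr1n => P0.
  by move: EP; rewrite P0.
have l_prime := pdiv_prime m1; set l := pdiv m in l_prime.
have lm : (l * (m %/ l) = m)%N by rewrite mulnC divnK // pdiv_dvd.
pose Q := P *+ (m %/ l).
have Ql : Q *+ l = 0 by rewrite /Q -mulrnA mulnC lm.
have q0 : (0 < m %/ l)%N by rewrite -(ltn_pmul2l (prime_gt0 l_prime)) lm muln0.
have Q0 : Q != 0.
  apply/eqP => Q0; have := m_min (m %/ l)%N; rewrite q0 -/Q Q0 eqxx => /(_ isT).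
  by rewrite leqNgt ltn_Pdiv // prime_gt1.
have [Ot rt _ kP] := nonint_in_kernel oc Kx Ky NO.
rewrite -EP in kP; have [kQ _] := in_kernel_muln (m %/ l) Ot rt kP.
have RQ : rational_point K (ec_val Q) by apply: ec_rational_muln; rewrite EP.
rewrite -/Q in kQ; case EQ : (ec_val Q) kQ RQ => [[u v]|]; last first.
  by move=> _ _; case/eqP: Q0; apply: val_inj.
move=> [v0 _ dv] [Ku Kv].
have ocQ : ec_oncurve E (Some (u, v)) by rewrite -EQ ec_valP.
(* Integral [u] would force integral [v], whereas [v^-1] has residue 0. *)
have NOu : ~ O u.
  move=> Ou; have Ov : O v.
    apply: pl_int_sqr => //; move/eqP: ocQ => ->.
    repeat first [assumption | exact: pl_int1 | apply: pl_intD | apply: pl_intM | apply: pl_intX].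
  have Ot3 : O ((x / y) ^+ 3) by apply: pl_intX.
  have rt3 : res ((x / y) ^+ 3) = 0 by rewrite pl_resX // rt expr0n.
  have := pl_resM Ov (pl_dvd_int Ot3 dv).
  by rewrite divff // pl_res1 (pl_dvd_res Ot3 rt3 dv) mulr0 => /eqP; rewrite oner_eq0.
have [Os rs s0 ks] := nonint_in_kernel ocQ Ku Kv NOu.
rewrite -EQ in ks; have [_] := in_kernel_muln l Os rs ks.
rewrite Ql EQ /= sub0r; move: (u / v) Os rs s0 => s Os rs s0 [w Ow Hw].
have {}Hw : l%:R = - (s ^+ 2 * w).
  by apply: (mulIf s0); rewrite -[LHS]opprK Hw !mulNr; congr (- _); rewrite exprS; ring.
have Os2w : O (s ^+ 2 * w) by apply: pl_intM => //; apply: pl_intX.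
have [lp|lp] := eqVneq l p; last first.
  have := res_prime_neq0 l_prime lp; rewrite -pl_res_nat Hw pl_resN // pl_resM ?pl_resX //.
    by rewrite rs expr0n mul0r oppr0 eqxx.
  exact: pl_intX.
(* For [l = p], writing [s = p s'] turns the relation into [p = - p^2 s'^2 w]; cancelling one [p]
   would make [p] invertible at the place. *)
have [s' Os' sE] := pl_unram Os rs.
have pn0 : p%:R != 0 :> algC by rewrite pnatr_eq0 -lt0n prime_gt0.
have : (1 : algC) = - (p%:R * (s' ^+ 2 * w)).
  by apply: (mulIf pn0); rewrite mul1r -{1}lp Hw sE; ring.
have Opw : O (s' ^+ 2 * w) by apply: pl_intM => //; apply: pl_intX.
have Op := pl_int_nat p.
have rp : res p%:R = 0 by rewrite pl_res_nat pchar_Fp_0.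
move/(congr1 res); rewrite pl_res1 pl_resN; last exact: pl_intM.
by rewrite pl_resM // rp mul0r oppr0 => /eqP; rewrite oner_eq0.
Qed.

(** * Injectivity of reduction on torsion and the counting argument *)

Hypothesis res_distinct : [&& res a != res b, res a != res c & res b != res c].

Definition torsion_point (P : ec_point E) : Prop :=
  rational_point K (ec_val P) /\ exists n, (0 < n)%N /\ P *+ n = 0.

Lemma torsion_pointB P Q : torsion_point P -> torsion_point Q -> torsion_point (P - Q).
Proof.
move=> [KP [m [m0 Pm]]] [KQ [n [n0 Qn]]]; split.
  rewrite ec_val_add; apply: ec_add_rational => //.
  by case: Q KQ {Qn} => [[[x y]|] ocQ] //= [? ?]; split=> //; apply: subfieldN.
exists (m * n)%N; rewrite muln_gt0 m0 n0; split=> //.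
by rewrite mulrnBl mulrnA Pm mul0rn sub0r mulnC mulrnA Qn mul0rn oppr0.
Qed.

(** The nonzero expression is the derivative [3 A x^2 + 2 B x + C], kept in the form of a divided
    difference to match its use in [reduction_inj]. *)
Lemma reduced_cubic_simple_root (x : 'F_p) :
  (res a * x + 1) * (res b * x + 1) * (res c * x + 1) = 0 ->
  res A * (x ^+ 2 + x * x + x ^+ 2) + res B * (x + x) + res C != 0.
Proof.
have -> : res A = res a * res b * res c by rewrite !pl_resM //; apply: pl_intM.
have -> : res B = res a * res b + res a * res c + res b * res c.
  by rewrite !pl_resD ?pl_resM //; try apply: pl_intD; apply: pl_intM.
have -> : res C = res a + res b + res c by rewrite !pl_resD //; apply: pl_intD.
case/and3P: Ares; case/and3P: res_distinct; move: (res a) (res b) (res c) => a' b' c' ab ac bc a0 b0 c0.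
have aux (u v w : 'F_p) : u != 0 -> u != v -> u != w -> u * x + 1 = 0 ->
    u * ((v * x + 1) * (w * x + 1)) != 0.
  move=> u0 uv uw ux.
  have nz t : u != t -> t * x + 1 != 0.
    move=> ut; apply: contra ut => /eqP tx; have : (u - t) * x = 0.
      rewrite (_ : _ * x = (u * x + 1) - (t * x + 1)); last by ring.
      by rewrite ux tx subrr.
    move/eqP; rewrite mulf_eq0 subr_eq0 => /orP[//|/eqP x0].
    by move/eqP: ux; rewrite x0 mulr0 add0r oner_eq0.
  by rewrite !mulf_neq0 ?nz.
move=> /eqP; rewrite !mulf_eq0 -orbA => /or3P[] /eqP H.
- rewrite (_ : _ + _ = a' * ((b' * x + 1) * (c' * x + 1)) +
    (a' * x + 1) * (b' * c' * x *+ 2 + b' + c')); last by ring.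
  by rewrite H mul0r addr0; apply: aux.
- rewrite (_ : _ + _ = b' * ((a' * x + 1) * (c' * x + 1)) +
    (b' * x + 1) * (a' * c' * x *+ 2 + a' + c')); last by ring.
  by rewrite H mul0r addr0; apply: aux => //; rewrite eq_sym.
- rewrite (_ : _ + _ = c' * ((a' * x + 1) * (b' * x + 1)) +
    (c' * x + 1) * (a' * b' * x *+ 2 + a' + b')); last by ring.
  by rewrite H mul0r addr0; apply: aux => //; rewrite eq_sym.
Qed.

Lemma reduced_point x y : ec_oncurve E (Some (x, y)) -> O x -> O y ->
  res y ^+ 2 = (res a * res x + 1) * (res b * res x + 1) * (res c * res x + 1).
Proof.
move=> /eqP oc Ox Oy; rewrite -pl_resX // oc -(pl_res1 pl).
rewrite (_ : _ + 1 = (a * x + 1) * (b * x + 1) * (c * x + 1)); last by ring.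
have O1 t : O t -> O (t * x + 1) by move=> Ot; apply: pl_intD; [apply: pl_intM | exact: pl_int1].
have r1 t : O t -> res (t * x + 1) = res t * res x + res 1.
  by move=> Ot; rewrite pl_resD ?pl_resM //; [apply: pl_intM | exact: pl_int1].
by rewrite !pl_resM ?r1 //; try apply: pl_intM; apply: O1.
Qed.

(* [P - Q] is torsion, hence integral, and so is the slope of the line that computes it;
   if [P] and [Q] have the same reduction, this makes the reduction a singular point. *)
Lemma reduction_inj (P Q : ec_point E) x1 y1 x2 y2 :
  torsion_point P -> torsion_point Q ->
  ec_val P = Some (x1, y1) -> ec_val Q = Some (x2, y2) ->
  res x1 = res x2 -> res y1 = res y2 -> P = Q.
Proof.
move=> tP tQ EP EQ rx ry; apply: val_inj; apply: (ec_add_opp_None (E := E)); apply/eqP.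
apply: contraT => /eqP PQ0.
have [KPQ [n [n0 PQn]]] := torsion_pointB tP tQ.
have intPQ := torsion_integral n0 PQn KPQ.
case: tP => KP [m [m0 Pm]]; have [] : O x1 /\ O y1 by have := torsion_integral m0 Pm KP; rewrite EP.
case: tQ => KQ [k [k0 Qk]]; have [] : O x2 /\ O y2 by have := torsion_integral k0 Qk KQ; rewrite EQ.
move=> Ox2 Oy2 Ox1 Oy1.
have ocP : ec_oncurve E (Some (x1, y1)) by rewrite -EP ec_valP.
have ocQ : ec_oncurve E (Some (x2, - y2)) by have := ec_opp_oncurve (ec_valP Q); rewrite EQ.
have PQE : ec_val (P - Q) = ec_add a b c (Some (x1, y1)) (Some (x2, - y2)).
  by rewrite ec_val_add /= EP EQ.
have N : ~~ ((x1 == x2) && (y1 == - - y2)).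
  apply/negP => H; apply: PQ0; rewrite /= EP EQ /=; by rewrite H.
have [l [nn [x3 [addE Y1 Y2 [H1 H2 H3]]]]] := ec_chord ocP ocQ N.
move: intPQ KPQ; rewrite PQE addE => -[Ox3 _] [Kx3 _].
have E1 : y1 + y2 = l * (x1 - x2) by rewrite -[y2]opprK Y2 Y1; ring.
have HH : l * (y1 - y2) = A * (x1 ^+ 2 + x1 * x2 + x2 ^+ 2) + B * (x1 + x2) + C.
  have -> : C = A * (x1 * x2 + x1 * x3 + x2 * x3) + 2%:R * l * nn by rewrite H2; ring.
  have -> : B = l ^+ 2 - A * (x1 + x2 + x3) by rewrite H1; ring.
  by rewrite -{1}[y2]opprK Y2 {1}Y1; move: A => kk; ring.
have Ol : O l.
  have Kl : K l.
    move: KP KQ; rewrite EP EQ => -[Kx1 Ky1] [Kx2 Ky2].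
    have [x12|x12] := eqVneq x1 x2; last first.
      have -> : l = (y1 + y2) / (x1 - x2) by rewrite E1 mulfK // subr_eq0.
      by apply: subfieldM => //; [apply: subfieldD | apply: subfieldV => //; apply: subfieldB].
    have y12 : y1 - y2 != 0 by move: N; rewrite x12 eqxx opprK subr_eq0.
    rewrite -(mulfK y12 l) HH; repeat first
      [assumption | apply: subfieldX | apply: subfieldB | apply: subfieldD
       | apply: subfieldM | apply: subfieldV].
  apply: pl_int_sqr => //; rewrite (_ : l ^+ 2 = A * (x1 + x2 + x3) + B); last by rewrite H1; ring.
  apply: pl_intD; last exact: int_B.
  by apply: pl_intM; [exact: int_A | do 2?apply: pl_intD].
have ry1 : res y1 = 0.
  move/(congr1 res): E1; rewrite pl_resD // pl_resM ?pl_resB //; last by apply: pl_intB.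
  rewrite rx ry subrr mulr0 -mulr2n -mulr_natr => /eqP.
  have two0 : (2%:R : 'F_p) != 0 by apply: res_prime_neq0; rewrite 1?eq_sym.
  by rewrite mulf_eq0 (negbTE two0) orbF => /eqP.
(* Thus [res x1] is a root of the reduced cubic. Reducing [HH], one side becomes the derivative
   there, the other 0, as [y1 - y2] reduces to 0. *)
have := reduced_point ocP Ox1 Oy1; rewrite ry1 expr0n => /esym /reduced_cubic_simple_root.
have OA := int_A; have OB := int_B; have OC := int_C.
have Os1 : O (x1 ^+ 2 + x1 * x2 + x2 ^+ 2).
  by rewrite !expr2; apply: pl_intD; [apply: pl_intD|]; apply: pl_intM.
have Os2 : O (x1 + x2) by apply: pl_intD.
set r := (X in X != _).
have -> : r = res (A * (x1 ^+ 2 + x1 * x2 + x2 ^+ 2) + B * (x1 + x2) + C).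
  rewrite {}/r.
  move: A B C OA OB OC => A' B' C' OA OB OC.
  rewrite !(pl_resD, pl_resM, pl_resX) ?rx //; repeat first
    [assumption | apply: pl_intX | apply: pl_intD | apply: pl_intM].
rewrite -HH pl_resM //; last by apply: pl_intB.
by rewrite pl_resB // ry subrr mulr0 eqxx.
Qed.

Definition reduced_curve : {set option ('F_p * 'F_p)} :=
  [set P | if P is Some (x, y) then
             y ^+ 2 == (res a * x + 1) * (res b * x + 1) * (res c * x + 1) else true].

Definition reduction (P : ecpoint) : option ('F_p * 'F_p) :=
  if P is Some (x, y) then Some (res x, res y) else None.

(** [T] injects into the torsion, and the torsion into a set with at most as many elements as [T];
    hence the image of [T] already fills the reduced curve. *)
Lemma torsion_exhausted (T : finType) (phi : T -> ec_point E) :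
  injective phi -> (forall u, torsion_point (phi u)) -> (#|reduced_curve| <= #|T|)%N ->
  forall P, torsion_point P -> exists u, phi u = P.
Proof.
move=> phi_inj phi_tors card P tP.
have red_in Q : torsion_point Q -> reduction (ec_val Q) \in reduced_curve.
  move=> [KQ [n [n0 Qn]]]; have := torsion_integral n0 Qn KQ; rewrite inE.
  by case EQ : (ec_val Q) => [[x y]|] //= [Ox Oy]; apply/eqP/reduced_point; rewrite // -EQ ec_valP.
have red_inj Q R : torsion_point Q -> torsion_point R ->
    reduction (ec_val Q) = reduction (ec_val R) -> Q = R.
  move=> tQ tR; case EQ : (ec_val Q) => [[x1 y1]|]; case ER : (ec_val R) => [[x2 y2]|] //=.
    by case=> rx ry; apply: reduction_inj EQ ER rx ry.
  by move=> _; apply: val_inj; rewrite /= EQ ER.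
have rphi_inj : injective (fun u => reduction (ec_val (phi u))).
  by move=> u v /red_inj H; apply: phi_inj; apply: H.
have sub : [set reduction (ec_val (phi u)) | u in T] \subset reduced_curve.
  by apply/subsetP => _ /imsetP[u _ ->]; apply: red_in.
have : [set reduction (ec_val (phi u)) | u in T] == reduced_curve.
  by rewrite eqEcard sub card_imset.
move=> /eqP img; have := red_in _ tP; rewrite -img => /imsetP[u _ /red_inj ->//].
by exists u.
Qed.

End Kernel.
End PlaceTheory.

(** * The curves with torsion [Z/2 x Z/12] *)

Lemma Fp_nat_eq p i j : prime p -> (i = j %[mod p])%N -> i%:R = j%:R :> 'F_p.
Proof. by move=> p_prime H; apply: val_inj; rewrite /= !val_Fp_nat. Qed.

Lemma F19_nat_eq i j : (i = j %[mod 19])%N -> i%:R = j%:R :> 'F_19.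
Proof. exact: Fp_nat_eq. Qed.

Lemma F19_neq0 n : (n %% 19 != 0)%N -> (n%:R : 'F_19) != 0.
Proof. by move=> n0; apply/eqP => /(congr1 val) /=; rewrite val_Fp_nat // => /eqP; rewrite (negbTE n0). Qed.

Lemma Fp_int_eq0 p (z : int) : prime p -> (z%:~R == 0 :> 'F_p) = (p %| `|z|)%N.
Proof.
move=> p_prime; have E n : (n%:R == 0 :> 'F_p) = (p %| n)%N by rewrite (dvdn_pcharf (pchar_Fp p_prime)).
case: z => n; first by rewrite -E.
by rewrite NegzE rmorphN oppr_eq0 abszN -E.
Qed.

(** Points are enumerated over natural numbers so that [vm_compute] can count them; reducing each
    factor keeps the unary numbers small. *)
Definition Fp_points (p k1 k2 k3 : nat) : seq (nat * nat) :=
  [seq xy <- [seq (x, y) | x <- iota 0 p, y <- iota 0 p] |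
    (xy.2 ^ 2 == (k1 * xy.1 + 1) %% p * ((k2 * xy.1 + 1) %% p) * ((k3 * xy.1 + 1) %% p)
      %[mod p])%N].

Lemma Fp_curve_card (p k1 k2 k3 : nat) : prime p ->
  (#|[set P : option ('F_p * 'F_p) | if P is Some (x, y) then
     (y ^+ 2 == (k1%:R * x + 1) * (k2%:R * x + 1) * (k3%:R * x + 1))%R else true]|
   <= (size (Fp_points p k1 k2 k3)).+1)%N.
Proof.
move=> p_prime; pose s : seq (option ('F_p * 'F_p)) :=
  None :: [seq Some (xy.1%:R, xy.2%:R) | xy <- Fp_points p k1 k2 k3].
have <- : size s = (size (Fp_points p k1 k2 k3)).+1 by rewrite /= size_map.
apply: leq_trans (card_size _); apply: subset_leq_card.
apply/subsetP => -[[x y]|]; rewrite in_set // => /eqP E.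
have lt_p (z : 'F_p) : (z < p)%N by rewrite -[X in (_ < X)%N](Fp_cast p_prime) ltn_ord.
rewrite inE; apply/mapP; exists (nat_of_ord x, nat_of_ord y); last by rewrite /= !natr_Zp.
rewrite mem_filter; apply/andP; split; last first.
  by apply/allpairsP; exists (nat_of_ord x, nat_of_ord y); rewrite !mem_iota !lt_p.
have /(congr1 val) : ((y ^ 2)%N%:R : 'F_p) =
   ((k1 * x + 1) * (k2 * x + 1) * (k3 * x + 1))%N%:R.
  by rewrite natrX !natrM !natrD !natrM !natr_Zp E.
by rewrite /= !val_Fp_nat // => ->; apply/eqP; rewrite modnMmr -[in RHS]modnMml modnMm modnMml.
Qed.

(** * Embedding Z/2 x Z/12 from elements of orders 2, 4 and 3 *)

Section Z2xZ12.
Variables (V : zmodType) (T Q U : V).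
Hypotheses (T2 : T *+ 2 = 0) (Q4 : Q *+ 4 = 0) (U3 : U *+ 3 = 0).
Hypotheses (T_neq0 : T != 0) (Q2_neq0 : Q *+ 2 != 0) (U_neq0 : U != 0) (TQ : T != Q *+ 2).

Definition Z2xZ12_map (u : 'Z_2 * 'Z_12) : V := T *+ u.1 + (Q + U) *+ u.2.

Lemma mulrn_modn (x : V) d n : x *+ d = 0 -> x *+ (n %% d) = x *+ n.
Proof. by move=> xd; rewrite {2}(divn_eq n d) mulrnDr mulnC mulrnA xd mul0rn add0r. Qed.

Lemma QU12 : (Q + U) *+ 12 = 0.
Proof. by rewrite mulrnDl -[12%N]/(4 * 3)%N mulrnA Q4 mulnC mulrnA U3 !mul0rn addr0. Qed.

Lemma Z2xZ12_mapD u v : Z2xZ12_map (u + v) = Z2xZ12_map u + Z2xZ12_map v.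
Proof.
case: u v => [u1 u2] [v1 v2]; rewrite /Z2xZ12_map /= addrACA -!mulrnDr.
by congr (_ + _); apply: mulrn_modn; [exact: T2 | exact: QU12].
Qed.

(** For [(i, j)] in the kernel, multiplying by 4 gives that 3 divides [j], multiplying by 2 that [j]
    is even, which leaves [j = 0] or [j = 6]. *)
Lemma Z2xZ12_map_inj : injective Z2xZ12_map.
Proof.
move=> u v uv; apply/eqP; rewrite -subr_eq0; apply/eqP.
have : Z2xZ12_map (u - v) = 0.
  by apply: (addIr (Z2xZ12_map v)); rewrite -Z2xZ12_mapD subrK add0r.
case: (u - v) => [i j]; rewrite /Z2xZ12_map /= => H.
have i2 : (i < 2)%N by apply: ltn_ord.
have j12 : (j < 12)%N by apply: ltn_ord.
suff [i0 j0] : (i : nat) = 0%N /\ (j : nat) = 0%N by congr (_, _); apply: val_inj.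
case: i j i2 j12 H => [i _] [j _] /= i2 j12 H.
have jmod3 : (j %% 3 = 0)%N.
  have U4j : U *+ j = 0.
    move/(congr1 (fun x => x *+ 4)): H; rewrite mul0rn mulrnDl -!mulrnA.
    have e2 : ((i * 4) %% 2 = 0)%N by lia.
    have e3 : ((4 * j) %% 3 = j %% 3)%N by lia.
    rewrite -(mulrn_modn (i * 4) T2) e2 mulr0n add0r.
    rewrite mulrnDl [(j * 4)%N]mulnC mulrnA Q4 mul0rn add0r.
    by rewrite -(mulrn_modn (4 * j) U3) e3 mulrn_modn.
  have := mulrn_modn j U3; rewrite U4j.
  case: (j %% 3)%N (ltn_pmod j (isT : 0 < 3)%N) => [|[|[|//]]] // _ U0.
    by move: U_neq0; rewrite -[U]mulr1n U0 eqxx.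
  by move: U3; rewrite mulrS U0 addr0 => U0'; move: U_neq0; rewrite U0' eqxx.
have UJ : U *+ j = 0 by rewrite -(mulrn_modn j U3) jmod3.
have {}H : T *+ i + Q *+ j = 0 by rewrite -H mulrnDl UJ addr0.
have jmod2 : (j %% 2 = 0)%N.
  move/(congr1 (fun x => x *+ 2)): H; rewrite mul0rn mulrnDl -!mulrnA.
  rewrite mulnC mulrnA T2 mul0rn add0r mulnC mulrnA.
  have Q22 : Q *+ 2 *+ 2 = 0 by rewrite -mulrnA.
  rewrite -(mulrn_modn j Q22); case: (j %% 2)%N (ltn_pmod j (isT : 0 < 2)%N) => [|[|//]] // _.
  by rewrite mulr1n => Q0; move: Q2_neq0; rewrite Q0 eqxx.
have [j0|j6] : j = 0%N \/ j = 6%N by move: j12 jmod3 jmod2; lia.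
  split=> //; move: H; rewrite j0 mulr0n addr0.
  by case: i i2 => [|[|//]] // _; rewrite mulr1n => T0; move: T_neq0; rewrite T0 eqxx.
(* Here [6 Q = 2 Q], which is nonzero; and [T + 2 Q = 0] would give [T = 2 Q], as [4 Q = 0]. *)
exfalso; move: H; rewrite j6 -[6%N]/(4 + 2)%N mulrnDr Q4 add0r.
case: i i2 => [|[|//]] // _; rewrite ?mulr0n ?add0r ?mulr1n => H.
  by move: Q2_neq0; rewrite H eqxx.
move/eqP: TQ; apply; apply: (addIr (Q *+ 2)).
by rewrite H -mulrnDr Q4.
Qed.

End Z2xZ12.

Section Family.
Variables (K : algC -> Prop) (pl : place K 19).
Hypothesis Ksub : is_subfield K.
Local Notation O := (pl_int pl).
Local Notation res := (pl_res pl).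
Variables a m w : algC.
Hypotheses (Ka : K a) (Km : K m) (Kw : K w) (Oa : O a) (ra : res a = 8%:R).
Hypotheses (w2 : w ^+ 2 = 2%:R * a + 1) (m2 : m ^+ 2 = a * (a + 2%:R)).

Let t1 := m^-1.
Let t2 := - m.
Let t3 := (1 - a ^+ 2) / m.

Lemma int_neq0 x : O x -> res x != 0 -> x != 0.
Proof. by move=> Ox; apply: contra => /eqP->; rewrite pl_res0. Qed.

Lemma int_a_nat k n : O (k%:R * a + n%:R).
Proof. by apply: pl_intD; [apply: pl_intM => //|]; apply: pl_int_nat. Qed.

Lemma res_a_nat k n : res (k%:R * a + n%:R) = (k * 8 + n)%N%:R.
Proof.
rewrite pl_resD ?pl_resM ?pl_res_nat ?ra ?natrD ?natrM //; try exact: pl_int_nat.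
by apply: pl_intM => //; apply: pl_int_nat.
Qed.

(** Nondegeneracy is decided modulo 19, where [a = 8]; no separate hypotheses on [a] are then
    required. *)
Lemma a_nat_neq0 k n : ((k * 8 + n) %% 19 != 0)%N -> k%:R * a + n%:R != 0.
Proof. by move=> H; apply: int_neq0; [exact: int_a_nat | rewrite res_a_nat; exact: F19_neq0]. Qed.

Lemma a_neq0 : a != 0. Proof. by have := @a_nat_neq0 1 0 isT; rewrite mul1r addr0. Qed.
Lemma aD1_neq0 : a + 1 != 0. Proof. by have := @a_nat_neq0 1 1 isT; rewrite mul1r. Qed.
Lemma aD2_neq0 : a + 2%:R != 0. Proof. by have := @a_nat_neq0 1 2 isT; rewrite mul1r. Qed.
Lemma aB1_neq0 : a - 1 != 0.
Proof.
apply: int_neq0; first by apply: pl_intB => //; exact: pl_int1.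
rewrite pl_resB // ?ra ?pl_res1; last exact: pl_int1.
exact: (@F19_neq0 7).
Qed.
Lemma w_neq0 : w != 0.
Proof. by have := @a_nat_neq0 2 1 isT; rewrite -w2 sqrf_eq0. Qed.
Lemma m_neq0 : m != 0.
Proof. by rewrite -sqrf_eq0 m2 mulf_neq0 ?a_neq0 ?aD2_neq0. Qed.

(** Each coincidence makes a square vanish: [(a + 1)^2] for [t1 = t2], [a^2] for [t1 = t3], [w^2]
    for [t2 = t3]. *)
Lemma triple_neq : [&& t1 != 0, t2 != 0, t3 != 0, t1 != t2, t1 != t3 & t2 != t3].
Proof.
have m0 := m_neq0; have a0 := a_neq0; have a1 := aD1_neq0; have a1' := aB1_neq0.
have key x : t2 = x / m -> m ^+ 2 = - x.
  by move=> H; rewrite expr2 -{1}[m]opprK -/t2 H mulNr divfK.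
apply/and5P; split; last (apply/andP; split).
- by rewrite invr_eq0.
- by rewrite oppr_eq0.
- rewrite mulf_neq0 ?invr_eq0 // (_ : 1 - a ^+ 2 = - ((a - 1) * (a + 1))); last by ring.
  by rewrite oppr_eq0 mulf_neq0.
- apply/eqP => H; have /key : t2 = 1 / m by rewrite div1r -/t1 H.
  move=> H1; have /eqP : (a + 1) ^+ 2 = 0.
    by rewrite (_ : _ ^+ 2 = a * (a + 2%:R) + 1); [rewrite -m2 H1 addNr | ring].
  by rewrite sqrf_eq0 (negbTE a1).
- apply/eqP => /(congr1 (fun x => x * m)); rewrite mulVf // divfK // => /eqP.
  by rewrite -subr_eq0 opprB addrC subrK sqrf_eq0 (negbTE a0).
- apply/eqP => /key; rewrite m2 => H; have /eqP : w ^+ 2 = 0.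
    by rewrite w2 (_ : _ + 1 = a * (a + 2%:R) + (1 - a ^+ 2)); [rewrite H addNr | ring].
  by rewrite sqrf_eq0 (negbTE w_neq0).
Qed.

Definition family_curve := EcParam triple_neq.
Local Notation E := family_curve.

(** [t1 t2 = -1] and [t2 t3 = a^2 - 1] settle two conditions for any [m]; the value of [m^2] turns
    the third, [t1 t3 + 1], into [(2 a + 1) / m^2]. *)
Lemma family_diophantine : diophantine_triple K t1 t2 t3.
Proof.
have m0 := m_neq0.
have Kt : K (1 - a ^+ 2).
  by apply: subfieldB => //; [exact: subfield1 | exact: subfieldX].
case/and5P: triple_neq => ? ? ? ? /andP[? ?]; split=> //.
  split; [exact: subfieldV | exact: subfieldN | apply: subfieldM => //; exact: subfieldV].
split.
- by exists 0; split; [exact: subfield0 | rewrite /t1 /t2 mulrN mulVf // addNr expr0n].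
- exists (w / m); split; first by apply: subfieldM => //; exact: subfieldV.
  rewrite /t1 /t3 expr_div_n w2; apply: (mulIf (mulf_neq0 m0 m0)); rewrite -expr2 divfK ?sqrf_eq0 //.
  rewrite (_ : _ * m ^+ 2 = 1 - a ^+ 2 + m ^+ 2); last by field.
  by rewrite m2; ring.
- by exists a; split=> //; rewrite /t2 /t3 mulNr mulrC divfK // opprB subrK.
Qed.

(* With [x' = m^2 (t1 t2 t3 x - 1)] these are the points [x' = - a^3 (a + 2)], [x' = a m w]
   and [x' = a^2] of [y'^2 = x' (x' + a^3 (a + 2)) (x' + 2 a + 1)]. *)
Definition pt_T := Some (- m, 0) : ecpoint.
Definition pt_Q := Some ((m + a * w) / (a ^+ 2 - 1), a * w * (w + a * m) / (m * (a ^+ 2 - 1))) : ecpoint.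
Definition pt_U := Some (2%:R * a / (m * (a - 1)), a * (a + 1) / ((a + 2%:R) * (a - 1))) : ecpoint.

Lemma curve_eq x y : y ^+ 2 = (t1 * x + 1) * (t2 * x + 1) * (t3 * x + 1) -> ec_oncurve E (Some (x, y)).
Proof. by move=> H; apply/eqP; rewrite H /=; ring. Qed.

Lemma a2B1_neq0 : a ^+ 2 - 1 != 0.
Proof. by rewrite (_ : _ - 1 = (a - 1) * (a + 1)); [rewrite mulf_neq0 ?aB1_neq0 ?aD1_neq0 | ring]. Qed.

Lemma T_oncurve : ec_oncurve E pt_T.
Proof. by apply: curve_eq; rewrite /t1 mulrN mulVf ?m_neq0 // addNr !mul0r expr0n. Qed.

Lemma Q_oncurve : ec_oncurve E pt_Q.
Proof.
have m0 := m_neq0; have a1 := a2B1_neq0.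
apply: curve_eq; rewrite /t1 /t2 /t3.
have -> : m^-1 * ((m + a * w) / (a ^+ 2 - 1)) + 1 = (a * w + a ^+ 2 * m) / (m * (a ^+ 2 - 1)).
  by field; rewrite m0 a1.
have -> : (1 - a ^+ 2) / m * ((m + a * w) / (a ^+ 2 - 1)) + 1 = - (a * w / m).
  by field; rewrite m0 a1.
have -> : - m * ((m + a * w) / (a ^+ 2 - 1)) + 1 = - (m ^+ 2 + a * w * m - a ^+ 2 + 1) / (a ^+ 2 - 1).
  by field; rewrite a1.
have -> : m ^+ 2 + a * w * m - a ^+ 2 + 1 = w * (w + a * m).
  by rewrite mulrDr -expr2 w2 m2; ring.
by field; rewrite m0 a1.
Qed.

Lemma U_oncurve : ec_oncurve E pt_U.
Proof.
have m0 := m_neq0; have a0 := a_neq0; have a1 := aB1_neq0; have a2 := aD2_neq0.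
apply: curve_eq; rewrite /t1 /t2 /t3.
have -> : m^-1 * (2%:R * a / (m * (a - 1))) + 1 = a ^+ 2 * (a + 1) / (m ^+ 2 * (a - 1)).
  have -> : m^-1 * (2%:R * a / (m * (a - 1))) + 1 = (2%:R * a + m ^+ 2 * (a - 1)) / (m ^+ 2 * (a - 1)).
    by field; rewrite m0 a1.
  by rewrite m2; field; rewrite ?a0 ?a1 ?a2.
have -> : - m * (2%:R * a / (m * (a - 1))) + 1 = - (a + 1) / (a - 1).
  by field; rewrite m0 a1.
have -> : (1 - a ^+ 2) / m * (2%:R * a / (m * (a - 1))) + 1 =
    (m ^+ 2 - 2%:R * a * (a + 1)) / m ^+ 2.
  by field; rewrite m0 a1.
by rewrite m2; field; rewrite ?a0 ?a1 ?a2.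
Qed.

(** Doublings are certified by exhibiting the tangent: two Vieta relations force [l] to be the slope
    of the formula, so the explicit points never require simplifying a quotient by [2 y1]. *)
Lemma ec_double (F : ec_param) x1 y1 l n x3 :
  ec_oncurve F (Some (x1, y1)) -> y1 != 0 -> y1 = l * x1 + n ->
  let A := ec_a F * ec_b F * ec_c F in
  let B := ec_a F * ec_b F + ec_a F * ec_c F + ec_b F * ec_c F in
  let C := ec_a F + ec_b F + ec_c F in
  A * (x1 + x1 + x3) = l ^+ 2 - B ->
  A * (x1 * x1 + x1 * x3 + x1 * x3) = C - 2%:R * l * n ->
  ec_add (ec_a F) (ec_b F) (ec_c F) (Some (x1, y1)) (Some (x1, y1)) = Some (x3, - (l * x3 + n)).
Proof.
move=> oc y0 Y A B C H1 H2; rewrite /ec_add !eqxx /=.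
have y2 : 2%:R * y1 != 0 by rewrite mulf_neq0 // pnatr_eq0.
have /negbTE -> : y1 != - y1 by rewrite -subr_eq0 opprK -mulr2n -mulr_natl.
rewrite -/A -/B -/C.
have <- : l = (3%:R * A * x1 ^+ 2 + 2%:R * B * x1 + C) / (2%:R * y1).
  apply: (mulIf y2); rewrite divfK //.
  have -> : C = A * (x1 * x1 + x1 * x3 + x1 * x3) + 2%:R * l * n by rewrite H2; ring.
  have -> : B = l ^+ 2 - A * (x1 + x1 + x3) by rewrite H1; ring.
  by rewrite Y; ring.
have -> : (l ^+ 2 - B) / A - x1 - x1 = x3.
  by rewrite -H1 mulrC mulKf; [ring | exact: ec_lead_neq0].
by rewrite Y; congr (Some (_, _)); ring.
Qed.

Definition T_point := EcPoint T_oncurve.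
Definition Q_point := EcPoint Q_oncurve.
Definition U_point := EcPoint U_oncurve.

Lemma T_double : T_point *+ 2 = 0.
Proof. by apply: val_inj; rewrite mulr2n -[LHS]/(ec_val (_ + _)) ec_val_add /= oppr0 !eqxx. Qed.

Lemma wDam_neq0 : w + a * m != 0.
Proof.
apply/eqP => H; have : w ^+ 2 = a ^+ 2 * m ^+ 2.
  by rewrite -exprMn; apply/eqP; rewrite eqf_sqr -addr_eq0 H eqxx orbT.
rewrite w2 m2 => H'; have /eqP : (a - 1) * (a + 1) ^+ 3 = 0.
  by rewrite (_ : _ * _ = a ^+ 2 * (a * (a + 2%:R)) - (2%:R * a + 1)); [rewrite H' subrr | ring].
by rewrite mulf_eq0 expf_eq0 /= (negbTE aB1_neq0) (negbTE aD1_neq0).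
Qed.

(** The abscissa is [- 1 / t3], a root of the cubic, whereas that of [T] is [- 1 / t1]; so [2 Q] has
    order 2 and can be told from [T]. *)
Lemma Q_double : ec_val (Q_point *+ 2) = Some (m / (a ^+ 2 - 1), 0).
Proof.
have m0 := m_neq0; have a1 := a2B1_neq0.
rewrite mulr2n ec_val_add.
rewrite (@ec_double E _ _ ((w + a * m) / m) (- (w + a * m) / (a ^+ 2 - 1)) (m / (a ^+ 2 - 1))).
- by congr (Some (_, _)); field; rewrite m0 a1.
- exact: Q_oncurve.
- by rewrite !mulf_neq0 ?invr_eq0 ?mulf_neq0 ?a_neq0 ?w_neq0 ?wDam_neq0.
- by field; rewrite m0 a1.
- by rewrite /= /t1 /t2 /t3; field: w2 m2; rewrite m0 a1.
- by rewrite /= /t1 /t2 /t3; field: w2 m2; rewrite m0 a1.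
Qed.

(** [U] is a flex: its tangent meets the curve there three times. *)
Lemma U_double : U_point *+ 2 = - U_point.
Proof.
have m0 := m_neq0; have a0 := a_neq0; have a1 := aB1_neq0; have a2 := aD2_neq0.
apply: val_inj; rewrite mulr2n -[LHS]/(ec_val (_ + _)) ec_val_add.
rewrite (@ec_double E _ _ ((a ^+ 2 + a + 1) / m) (- (a ^+ 2 + a + 2%:R) / ((a + 2%:R) * (a - 1)))
  (2%:R * a / (m * (a - 1)))).
- by congr (Some (_, - _)); field: m2; rewrite m0 a1 a2.
- exact: U_oncurve.
- by rewrite !mulf_neq0 ?invr_eq0 ?mulf_neq0 ?a_neq0 ?aD1_neq0.
- by field: m2; rewrite m0 a1 a2.
- by rewrite /= /t1 /t2 /t3; field: m2; rewrite m0 a1.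
- by rewrite /= /t1 /t2 /t3; field: m2; rewrite m0 a1 a2.
Qed.

Lemma int_m : O m.
Proof.
apply: (pl_int_sqr Km); rewrite m2; apply: pl_intM => //; apply: pl_intD => //; exact: pl_int_nat.
Qed.

Lemma res_m : res m = 2%:R \/ res m = 17%:R.
Proof.
have : res m ^+ 2 == 2%:R ^+ 2.
  have := res_a_nat 1 2; rewrite mul1r => r2.
  rewrite -pl_resX ?m2 ?pl_resM ?ra ?r2 //; last by exact: int_m.
  by have := int_a_nat 1 2; rewrite mul1r.
rewrite eqf_sqr => /orP[] /eqP ->; [by left | right].
by apply/eqP; rewrite eq_sym -addr_eq0 -natrD; apply/eqP; apply: (@F19_nat_eq _ 0).
Qed.

Lemma res_m_neq0 : res m != 0.
Proof. by case: res_m => ->; apply: F19_neq0. Qed.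

(** Modulo 19, [1 - a^2 = -63 = 13], and [m^2 = 80 = 4], so [m] is 2 or 17, with inverse 10 or 9.
    The two triples are negatives of each other: [x -> - x] identifies the reduced curves. *)
Lemma res_triple :
  [/\ res t1 = 10%:R, res t2 = 17%:R & res t3 = 16%:R] \/
  [/\ res t1 = 9%:R, res t2 = 2%:R & res t3 = 3%:R].
Proof.
have Om := int_m; have rm := res_m_neq0.
have O1a : O (1 - a ^+ 2) by apply: pl_intB; [exact: pl_int1 | exact: pl_intX].
have r1a : res (1 - a ^+ 2) = 13%:R.
  rewrite pl_resB ?pl_res1 ?pl_resX ?ra //; [|exact: pl_int1|exact: pl_intX].
  by apply/eqP; rewrite subr_eq -natrX -natrD; apply/eqP; apply: (@F19_nat_eq 1).
have inv k : res m * k%:R = 1 -> res t1 = k%:R /\ res t3 = (13 * k)%N%:R.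
  move=> H; have H' : res m^-1 = k%:R.
    by rewrite pl_resV //; apply: (mulfI rm); rewrite mulfV.
  by rewrite /t1 /t3 pl_resM // ?r1a ?H' ?natrM //; exact: pl_intV.
have rt2 : res t2 = - res m by rewrite /t2 pl_resN.
case: res_m => rmE; [left | right].
  have [-> ->] : res t1 = 10%:R /\ res t3 = (13 * 10)%N%:R.
    by apply: inv; rewrite rmE -natrM; apply: (@F19_nat_eq _ 1).
  rewrite rt2 rmE; split=> //; last exact: F19_nat_eq.
  by apply/eqP; rewrite eq_sym -addr_eq0 -natrD; apply/eqP; apply: (@F19_nat_eq _ 0).
have [-> ->] : res t1 = 9%:R /\ res t3 = (13 * 9)%N%:R.
  by apply: inv; rewrite rmE -natrM; apply: (@F19_nat_eq _ 1).
rewrite rt2 rmE; split=> //; last exact: F19_nat_eq.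
by apply/eqP; rewrite eq_sym -addr_eq0 -natrD; apply/eqP; apply: (@F19_nat_eq _ 0).
Qed.

Lemma res_triple_neq : [&& res t1 != 0, res t2 != 0 & res t3 != 0] &&
  [&& res t1 != res t2, res t1 != res t3 & res t2 != res t3].
Proof.
have nz i j : (i < j)%N -> ((j - i) %% 19 != 0)%N -> i%:R != j%:R :> 'F_19.
  by move=> /ltnW ij H; rewrite eq_sym -subr_eq0 -natrB //; apply: F19_neq0.
have nz' i j : (i < j)%N -> ((j - i) %% 19 != 0)%N -> j%:R != i%:R :> 'F_19.
  by move=> ij H; rewrite eq_sym nz.
by case: res_triple => -[-> -> ->]; rewrite !F19_neq0 //=; apply/and3P; split;
  first [exact: nz | exact: nz'].
Qed.

Lemma card_reduced_curve : (#|reduced_curve pl E| <= 24)%N.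
Proof.
rewrite /reduced_curve /=.
by case: res_triple => -[-> -> ->]; apply: leq_trans (Fp_curve_card _ _ _ _) _ => //; vm_compute.
Qed.

Lemma T_rational : rational_point K pt_T.
Proof. by split; [exact: subfieldN | exact: subfield0]. Qed.

Lemma Q_rational : rational_point K pt_Q.
Proof.
by split; repeat first [assumption | exact: subfield1 | apply: subfieldX | apply: subfieldB
  | apply: subfieldD | apply: subfieldM | apply: subfieldV].
Qed.

Lemma U_rational : rational_point K pt_U.
Proof.
by split; repeat first [assumption | exact: subfield1 | apply: subfield_nat | apply: subfieldX
  | apply: subfieldB | apply: subfieldD | apply: subfieldM | apply: subfieldV].
Qed.

Lemma family_torsion : torsion_Z2xZ12 K t1 t2 t3.
Proof.
have [Kt1 Kt2 Kt3] : [/\ K t1, K t2 & K t3] by case: family_diophantine.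
have m0 := m_neq0; have Om := int_m.
have Ot1 : O t1 by apply: pl_intV => //; exact: res_m_neq0.
have Ot2 : O t2 by apply: pl_intN.
have Ot3 : O t3.
  by apply: pl_intM => //; apply: pl_intB; [exact: pl_int1 | exact: pl_intX].
have /andP[rne rdist] := res_triple_neq.
pose T := T_point; pose Q := Q_point; pose U := U_point.
have Q4 : Q *+ 4 = 0.
  rewrite -[4%N]/(2 * 2)%N mulrnA; apply: val_inj.
  by rewrite mulr2n -[LHS]/(ec_val (_ + _)) ec_val_add Q_double /= oppr0 !eqxx.
have U3 : U *+ 3 = 0 by rewrite mulrS U_double subrr.
have T0 : T != 0 by apply/eqP => /(congr1 (@ec_val E)).
have U0 : U != 0 by apply/eqP => /(congr1 (@ec_val E)).
have Q20 : Q *+ 2 != 0 by apply/eqP => /(congr1 (@ec_val E)); rewrite Q_double.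
have TQ : T != Q *+ 2.
  apply/eqP => /(congr1 (@ec_val E)); rewrite Q_double => -[] H.
  have : a ^+ 2 * m = 0.
    by have := congr1 (fun x => x * (a ^+ 2 - 1)) H; rewrite divfK ?a2B1_neq0 // => H';
       rewrite (_ : _ * m = m - - m * (a ^+ 2 - 1)); [rewrite H' subrr | ring].
  by move/eqP; rewrite mulf_eq0 sqrf_eq0 (negbTE a_neq0) (negbTE m0).
pose phi := Z2xZ12_map T Q U.
have phi_inj : injective phi := Z2xZ12_map_inj T_double Q4 U3 T0 Q20 U0 TQ.
have phiD := Z2xZ12_mapD T_double Q4 U3.
have phi_tors u : torsion_point K (phi u).
  split.
    rewrite /phi /Z2xZ12_map ec_val_add; apply: ec_add_rational => //;
      apply: ec_rational_muln => //; first exact: T_rational.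
    by rewrite ec_val_add; apply: ec_add_rational => //; [exact: Q_rational | exact: U_rational].
  exists 12; split=> //; rewrite /phi /Z2xZ12_map mulrnDl -!mulrnA ![(_ * 12)%N]mulnC.
  by rewrite [X in _ *+ X + _](_ : _ = 2 * (6 * u.1))%N ?mulnA // !mulrnA T_double QU12 // !mul0rn addr0.
have surj : forall P : ec_point E, torsion_point K P -> exists u, phi u = P.
  apply: (torsion_exhausted (pl := pl)) phi_inj phi_tors _ => //.
  by rewrite card_prod !card_ord; exact: card_reduced_curve.
exists (fun u => ec_val (phi u)); split.
- move=> u; have [Ru [n [n0 Pn]]] := phi_tors u; split.
    have := ec_valP (phi u); move: Ru; case: (ec_val (phi u)) => [[x y]|] //= [Kx Ky] /eqP H.
    by split=> //; rewrite H /=; ring.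
  by exists n; split=> //; rewrite -[LHS]/(ec_mul (ec_a E) (ec_b E) (ec_c E) n _) -ec_val_muln Pn.
- by move=> u v H; apply: phi_inj; apply: val_inj.
- move=> P [oc [n [n0 Pn]]].
  have ocE : ec_oncurve E P.
    by case: P oc {Pn} => [[x y]|] //= [_ _ H]; apply: curve_eq.
  have RP : rational_point K P by case: P oc {Pn ocE} => [[x y]|] //= [].
  have [|u Hu] := surj (EcPoint ocE).
    split=> //; exists n; split=> //; apply: val_inj.
    by rewrite -[LHS]/(ec_val _) ec_val_muln.
  by exists u; rewrite Hu.
- by move=> u v; rewrite /phi phiD ec_val_add.
Qed.

End Family.

(** * Quadratic fields and their split places *)

Section Quadratic.
Variables (alpha : algC) (h : int).
Hypothesis alpha2 : alpha ^+ 2 = h%:~R.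
Hypothesis h_nonsquare : forall r : rat, r ^+ 2 != h%:~R.

Definition quad (x : algC) : Prop := exists p q : rat, x = ratr p + ratr q * alpha.

Lemma alpha2_rat : alpha ^+ 2 = ratr h%:~R.
Proof. by rewrite ratr_int. Qed.

Lemma quad_indep (p q : rat) : ratr p + ratr q * alpha = 0 :> algC -> p = 0 /\ q = 0.
Proof.
move=> H; have [q0|q0] := eqVneq q 0.
  by move: H; rewrite q0 rmorph0 mul0r addr0 => /eqP; rewrite fmorph_eq0 => /eqP.
have /eqP[] := h_nonsquare (p / q).
apply: (fmorph_inj (ratr : {rmorphism rat -> algC})) => /=.
rewrite -alpha2_rat rmorphXn fmorph_div /= expr_div_n.
have rq0 : ratr q != 0 :> algC by rewrite fmorph_eq0.
have -> : ratr p = - (ratr q * alpha) :> algC by apply/eqP; rewrite -addr_eq0 H.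
by field.
Qed.

Lemma quad_norm_neq0 (p q : rat) : ratr p + ratr q * alpha != 0 :> algC ->
  ratr p - ratr q * alpha != 0 :> algC.
Proof.
apply: contra => /eqP H; have [-> q0] : p = 0 /\ - q = 0.
  by apply: quad_indep; rewrite rmorphN mulNr.
by move/eqP: q0; rewrite oppr_eq0 => /eqP ->; rewrite rmorph0 mul0r addr0.
Qed.

Lemma quad_subfield : is_subfield quad.
Proof.
split.
- by exists 0, 0; rewrite rmorph0 mul0r addr0.
- by exists 1, 0; rewrite rmorph0 rmorph1 mul0r addr0.
- by move=> _ _ [p [q ->]] [p' [q' ->]]; exists (p - p'), (q - q'); rewrite !rmorphB /=; ring.
- move=> _ _ [p [q ->]] [p' [q' ->]]; exists (p * p' + q * q' * h%:~R), (p * q' + q * p').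
  by rewrite !rmorphD !rmorphM /= -alpha2_rat; ring.
- move=> _ [p [q ->]] x0; have y0 := quad_norm_neq0 x0.
  pose N := p ^+ 2 - q ^+ 2 * h%:~R.
  have NE : ratr N = (ratr p + ratr q * alpha) * (ratr p - ratr q * alpha) :> algC.
    by rewrite /N !expr2 rmorphB !rmorphM /= -alpha2_rat; ring.
  exists (p / N), (- q / N); rewrite !fmorph_div rmorphN /= NE.
  by field; rewrite x0 y0.
Qed.

Lemma quad_alpha : quad alpha.
Proof. by exists 0, 1; rewrite rmorph0 rmorph1 mul1r add0r. Qed.

Lemma quad_quadratic : quadratic_field quad.
Proof.
split; first exact: quad_subfield.
by exists alpha; split; [exact: quad_alpha | exact: quad_indep | ].
Qed.

(** * The place of the quadratic field given by a square root of [h] modulo [p] *)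

Section Split.
Variables (p : nat) (s : 'F_p).
Hypotheses (p_prime : prime p) (p_odd : p != 2%N) (s2 : s ^+ 2 = h%:~R) (s_neq0 : s != 0).

Definition zel (u v : int) : algC := u%:~R + v%:~R * alpha.
Definition zred (u v : int) : 'F_p := u%:~R + v%:~R * s.

Lemma zelM u v u' v' : zel u v * zel u' v' = zel (u * u' + v * v' * h) (u * v' + v * u').
Proof. by rewrite /zel !rmorphD !rmorphM /= -alpha2; ring. Qed.

Lemma zredM u v u' v' : zred u v * zred u' v' = zred (u * u' + v * v' * h) (u * v' + v * u').
Proof. by rewrite /zred !rmorphD !rmorphM /= -s2; ring. Qed.

Lemma zelB u v u' v' : zel u v - zel u' v' = zel (u - u') (v - v').
Proof. by rewrite /zel !rmorphB /=; ring. Qed.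

Lemma zredB u v u' v' : zred u v - zred u' v' = zred (u - u') (v - v').
Proof. by rewrite /zred !rmorphB /=; ring. Qed.

Lemma zel_eq0 u v : zel u v = 0 -> u = 0 /\ v = 0.
Proof.
rewrite /zel -(ratr_int algC u) -(ratr_int algC v) => /quad_indep [/eqP + /eqP].
by rewrite !intr_eq0 => /eqP -> /eqP ->.
Qed.

Lemma zel_neq0 u v : zred u v != 0 -> zel u v != 0.
Proof. by apply: contra => /eqP /zel_eq0 [-> ->]; rewrite /zred !rmorph0 mul0r addr0. Qed.

(** The graph of reduction on [Z[alpha]] localized at the prime where [alpha] becomes [s]. It is a
    relation since an element has many representations as a fraction; [residue_rel_uniq] makes it
    functional. *)
Definition residue_rel (x : algC) (r : 'F_p) : Prop := exists u v u' v',
  [/\ zred u' v' != 0, x * zel u' v' = zel u v & r * zred u' v' = zred u v].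

Lemma residue_rel_zel u v : residue_rel (zel u v) (zred u v).
Proof.
exists u, v, 1, 0; rewrite /zel /zred !rmorph0 !rmorph1 !mul0r !addr0 !mulr1.
by rewrite oner_neq0.
Qed.

Lemma residue_rel1 : residue_rel 1 1.
Proof. by have := residue_rel_zel 1 0; rewrite /zel /zred !rmorph0 !rmorph1 !mul0r !addr0. Qed.

Lemma residue_relM x r y t : residue_rel x r -> residue_rel y t -> residue_rel (x * y) (r * t).
Proof.
move=> [u [v [u' [v' [n0 H R]]]]] [u1 [v1 [u1' [v1' [n1 H1 R1]]]]].
exists (u * u1 + v * v1 * h), (u * v1 + v * u1), (u' * u1' + v' * v1' * h), (u' * v1' + v' * u1').
by rewrite -!zelM -!zredM -H -H1 -R -R1; split; [exact: mulf_neq0 | ring | ring].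
Qed.

Lemma residue_relB x r y t : residue_rel x r -> residue_rel y t -> residue_rel (x - y) (r - t).
Proof.
move=> [u [v [u' [v' [n0 H R]]]]] [u1 [v1 [u1' [v1' [n1 H1 R1]]]]].
exists (u * u1' + v * v1' * h - (u' * u1 + v' * v1 * h)),
  (u * v1' + v * u1' - (u' * v1 + v' * u1)), (u' * u1' + v' * v1' * h), (u' * v1' + v' * u1').
by rewrite -zelB -zredB -!zelM -!zredM -H -H1 -R -R1; split; [exact: mulf_neq0 | ring | ring].
Qed.

Lemma residue_relV x r : residue_rel x r -> r != 0 -> residue_rel x^-1 r^-1.
Proof.
move=> [u [v [u' [v' [n0 H R]]]]] r0; exists u', v', u, v; rewrite -H -R.
have z0 := zel_neq0 n0; have rz : zred u v != 0 by rewrite -R mulf_neq0.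
have x0 : x != 0 by apply: contra (zel_neq0 rz); rewrite -H => /eqP ->; rewrite mul0r.
by split; [exact: mulf_neq0 | rewrite mulKf | rewrite mulKf].
Qed.

Lemma residue_rel_uniq x r t : residue_rel x r -> residue_rel x t -> r = t.
Proof.
move=> Hr Ht; apply/eqP; rewrite -subr_eq0; have := residue_relB Hr Ht.
rewrite subrr => -[u [v [u' [v' [n0 + R]]]]]; rewrite mul0r => /esym /zel_eq0 [u0 v0].
by move: R; rewrite u0 v0 /zred !rmorph0 mul0r addr0 => /eqP; rewrite mulf_eq0 (negbTE n0) orbF.
Qed.

Lemma residue_rel_nat n : residue_rel n%:R n%:R.
Proof. by have := residue_rel_zel n 0; rewrite /zel /zred !rmorph0 !mul0r !addr0. Qed.

Lemma residue_rel_quad x r : residue_rel x r -> quad x.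
Proof.
move=> [u [v [u' [v' [/zel_neq0 z0 H _]]]]].
have -> : x = zel u v * (zel u' v')^-1 by rewrite -H mulfK.
have qz a b : quad (zel a b) by exists a%:~R, b%:~R; rewrite !ratr_int.
by apply: (subfieldM quad_subfield) => //; apply: (subfieldV quad_subfield).
Qed.

(* Unless [p] divides both [u] and [v], one of [u + v s] and [u - v s] is a unit
   modulo [p]; in the second case divide the norm by the conjugate. *)
Lemma zel_factor u v : zel u v != 0 ->
  exists k e r, [/\ residue_rel e r, r != 0 & zel u v = p%:R ^+ k * e].
Proof.
have [n] := ubnP (`|u| + `|v|)%N; elim: n u v => // n IH u v lt_n z0.
have [ru|ru] := eqVneq (zred u v) 0; last first.
  by exists 0%N, (zel u v), (zred u v); rewrite expr0 mul1r; split=> //; exact: residue_rel_zel.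
have [rc|rc] := eqVneq (zred u (- v)) 0.
  have two0 : (2%:R : 'F_p) != 0.
    by have := Fp_int_eq0 2 p_prime; rewrite /= dvdn_prime2 // (negbTE p_odd) => /negbT.
  have /eqP v0 : (v%:~R : 'F_p) == 0.
    have /eqP : 2%:R * (v%:~R * s) = 0 :> 'F_p.
      rewrite -[RHS](subrr (0 : 'F_p)) -{1}ru -rc /zred rmorphN /=; ring.
    by rewrite !mulf_eq0 (negbTE two0) (negbTE s_neq0) orbF.
  have /eqP u0 : (u%:~R : 'F_p) == 0 by move/eqP: ru; rewrite /zred v0 mul0r addr0.
  have /dvdnP[u1 Hu] : (p %| `|u|)%N by rewrite -(Fp_int_eq0 u p_prime) u0.
  have /dvdnP[v1 Hv] : (p %| `|v|)%N by rewrite -(Fp_int_eq0 v p_prime) v0.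
  pose u' := sgz u * u1%:Z; pose v' := sgz v * v1%:Z.
  have uE : u = u' * p%:Z by rewrite {1}(intEsg u) Hu PoszM mulrA.
  have vE : v = v' * p%:Z by rewrite {1}(intEsg v) Hv PoszM mulrA.
  have zE : zel u v = p%:R * zel u' v'.
    by rewrite /zel uE vE !rmorphM /=; ring.
  have z1 : zel u' v' != 0 by apply: contra z0; rewrite zE => /eqP->; rewrite mulr0.
  have [|k [e [r [H1 H2 H3]]]] := IH u' v' _ z1; last first.
    by exists k.+1, e, r; split=> //; rewrite zE H3 exprS mulrA.
  have p2 := prime_gt1 p_prime.
  have : (`|u| + `|v| != 0)%N.
    rewrite addn_eq0 !absz_eq0; apply: contra z0 => /andP[/eqP-> /eqP->].
    by rewrite /zel !rmorph0 mul0r addr0.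
  have aE a b : a = b * p%:Z -> (`|a| = `|b| * p)%N by move=> ->; rewrite abszM.
  by move: lt_n; rewrite (aE _ _ uE) (aE _ _ vE); move: p2; clear; nia.
pose N := u ^+ 2 - v ^+ 2 * h.
have NE : zel u v * zel u (- v) = N%:~R.
  by rewrite zelM /zel (_ : _ + v * u = 0) ?rmorph0 ?mul0r ?addr0; [congr _%:~R; rewrite /N; ring | ring].
have zc0 := zel_neq0 rc.
have N0 : N != 0 by rewrite -(intr_eq0 algC) -NE mulf_neq0.
have absN0 : (0 < `|N|)%N by rewrite absz_gt0.
have [k [M [cM HM]]] : exists k M, ~~ (p %| M)%N /\ `|N|%N = (p ^ k * M)%N.
  have [M cM HM] := pfactor_coprime p_prime absN0.
  by exists (logn p `|N|), M; rewrite -prime_coprime // mulnC.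
have rM : residue_rel (sgz N * M%:Z)%:~R (sgz N * M%:Z)%:~R.
  by have := residue_rel_zel (sgz N * M%:Z) 0; rewrite /zel /zred !rmorph0 !mul0r !addr0.
have M0 : (sgz N * M%:Z)%:~R != 0 :> 'F_p.
  by rewrite Fp_int_eq0 // abszM (_ : `|sgz N| = 1)%N ?mul1n // sgz_def N0; case: (N < 0).
exists k, ((sgz N * M%:Z)%:~R * (zel u (- v))^-1), ((sgz N * M%:Z)%:~R * (zred u (- v))^-1).
split.
- by apply: residue_relM => //; apply: residue_relV => //; exact: residue_rel_zel.
- by rewrite mulf_neq0 ?invr_eq0.
- apply: (mulIf zc0); rewrite NE -mulrA mulfVK // {1}(intEsg N) HM PoszM !rmorphM /=.
  by rewrite -natrX; ring.
Qed.

(** The valuation of [x] is [k - j]; two natural exponents avoid negative powers of [p]. *)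
Lemma quad_valuation x : quad x -> x != 0 ->
  exists k j e r, [/\ residue_rel e r, r != 0 & x * p%:R ^+ j = p%:R ^+ k * e].
Proof.
move=> [a [b xE]] x0; pose w := denq a * denq b.
pose u := numq a * denq b; pose v := numq b * denq a.
have w0 : zel w 0 != 0 by rewrite /zel rmorph0 mul0r addr0 intr_eq0 mulf_neq0 ?denq_neq0.
have xw : x * zel w 0 = zel u v.
  have aE : ratr a = (numq a)%:~R / (denq a)%:~R :> algC by [].
  have bE : ratr b = (numq b)%:~R / (denq b)%:~R :> algC by [].
  have da : (denq a)%:~R != 0 :> algC by rewrite intr_eq0 denq_neq0.
  have db : (denq b)%:~R != 0 :> algC by rewrite intr_eq0 denq_neq0.
  rewrite xE aE bE /zel /u /v /w rmorph0 !rmorphM /= mul0r addr0; field; by rewrite da db.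
have uv0 : zel u v != 0 by rewrite -xw mulf_neq0.
have [k [e [r [He r0 uvE]]]] := zel_factor uv0.
have [j [e' [r' [He' r'0 wE]]]] := zel_factor w0.
have e'0 : e' != 0 by apply: contra w0; rewrite wE => /eqP->; rewrite mulr0.
exists k, j, (e * e'^-1), (r * r'^-1); split.
- by apply: residue_relM => //; exact: residue_relV.
- by rewrite mulf_neq0 ?invr_eq0.
- by apply: (mulIf e'0); rewrite -!mulrA mulVf // mulr1 -wE xw uvE.
Qed.

Definition quad_int (x : algC) : Prop := exists r, residue_rel x r.
(** Classical choice of the residue; outside [quad_int] the value is unspecified. *)
Definition quad_res (x : algC) : 'F_p := epsilon (inhabits 0) (residue_rel x).

Lemma quad_resE x r : residue_rel x r -> quad_res x = r.
Proof.
move=> Hr; apply: (@residue_rel_uniq x) => //.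
by apply: epsilon_spec; exists r.
Qed.

Lemma quad_valuation_ring x : quad x -> quad_int x \/ quad_int x^-1.
Proof.
move=> Kx; have [->|x0] := eqVneq x 0.
  by left; exists (0%:R); exact: (residue_rel_nat 0).
have [k [j [e [r [He r0 xE]]]]] := quad_valuation Kx x0.
have pk n : residue_rel (p%:R ^+ n) (p ^ n)%N%:R by rewrite -natrX; exact: residue_rel_nat.
have pn0 n : p%:R ^+ n != 0 :> algC by rewrite expf_neq0 // pnatr_eq0 -lt0n prime_gt0.
have [jk|/ltnW kj] := leqP j k.
  left; exists ((p ^ (k - j))%N%:R * r).
  have -> : x = p%:R ^+ (k - j) * e.
    by apply: (mulIf (pn0 j)); rewrite xE mulrAC -exprD subnK.
  exact: residue_relM.
right; exists ((p ^ (j - k))%N%:R * r^-1).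
have e0 : e != 0 by apply: contra x0 => /eqP e0; rewrite -(mulIr_eq0 _ (mulIf (pn0 j))) xE e0 mulr0.
have -> : x^-1 = p%:R ^+ (j - k) * e^-1.
  apply: (mulfI x0); rewrite mulfV //; apply: (mulIf (pn0 k)); apply: (mulIf e0).
  rewrite mul1r -xE (_ : _ * e = x * (p%:R ^+ (j - k) * p%:R ^+ k) * (e^-1 * e)); last by ring.
  by rewrite mulVf // mulr1 -exprD subnK.
by apply: residue_relM => //; exact: residue_relV.
Qed.

(** The valuation [k - j] is positive: otherwise [e = x p^(j - k)] would have residue 0 beside its
    nonzero residue [r]. *)
Lemma quad_unramified x : quad_int x -> quad_res x = 0 ->
  exists2 y, quad_int y & x = p%:R * y.
Proof.
move=> [t Ht]; rewrite (quad_resE Ht) => t0; rewrite {}t0 in Ht.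
have [->|x0] := eqVneq x 0.
  by exists 0; [exists 0%:R; exact: (residue_rel_nat 0) | rewrite mulr0].
have [k [j [e [r [He r0 xE]]]]] := quad_valuation (residue_rel_quad Ht) x0.
have pk n : residue_rel (p%:R ^+ n) (p ^ n)%N%:R by rewrite -natrX; exact: residue_rel_nat.
have pn0 n : p%:R ^+ n != 0 :> algC by rewrite expf_neq0 // pnatr_eq0 -lt0n prime_gt0.
have [kj|jk] := leqP k j; last first.
  exists (p%:R ^+ (k - j).-1 * e).
    by exists ((p ^ (k - j).-1)%N%:R * r); apply: residue_relM.
  apply: (mulIf (pn0 j)); rewrite xE mulrA -exprS prednK ?subn_gt0 //.
  by rewrite mulrAC -exprD subnK // ltnW.
have E : e = x * p%:R ^+ (j - k).
  by apply: (mulfI (pn0 k)); rewrite -xE mulrCA -exprD subnKC.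
have := residue_relM Ht (pk (j - k)%N); rewrite -E => He0.
by move: r0; rewrite (residue_rel_uniq He He0) mul0r eqxx.
Qed.

Definition quad_place : place quad p.
Proof.
apply: (@Place quad p quad_int quad_res).
- by exists 1; exact: residue_rel1.
- by move=> x y [r Hr] [t Ht]; exists (r - t); exact: residue_relB.
- by move=> x y [r Hr] [t Ht]; exists (r * t); exact: residue_relM.
- by apply: quad_resE; exact: residue_rel1.
- move=> x y [r Hr] [t Ht]; rewrite (quad_resE Hr) (quad_resE Ht).
  by apply: quad_resE; exact: residue_relB.
- move=> x y [r Hr] [t Ht]; rewrite (quad_resE Hr) (quad_resE Ht).
  by apply: quad_resE; exact: residue_relM.
- move=> x [r Hr]; rewrite (quad_resE Hr) => r0; exists r^-1; exact: residue_relV.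
- exact: quad_valuation_ring.
- exact: quad_unramified.
Defined.

End Split.
End Quadratic.

(** * The orbit under doubling *)

Lemma pl_int_int K p (pl : place K p) (z : int) : pl_int pl z%:~R.
Proof.
by case: z => n; rewrite ?NegzE ?rmorphN; [|apply: pl_intN]; exact: pl_int_nat.
Qed.

Lemma pl_res_int K p (pl : place K p) (z : int) : pl_res pl z%:~R = z%:~R.
Proof.
case: z => n; first exact: pl_res_nat.
by rewrite NegzE !rmorphN pl_resN ?pl_res_nat //; exact: pl_int_nat.
Qed.

Lemma subfield_int K (z : int) : is_subfield K -> K z%:~R.
Proof.
move=> Ksub; case: z => n; first exact: subfield_nat.
by rewrite NegzE rmorphN; apply: subfieldN => //; exact: subfield_nat.
Qed.

Definition hform (u v : int) : int := u * v * (u ^+ 2 - u * v + v ^+ 2).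
Lemma hform_intr (R : comNzRingType) u v : (hform u v)%:~R =
  u%:~R * v%:~R * (u%:~R ^+ 2 - u%:~R * v%:~R + v%:~R ^+ 2) :> R.
Proof. by rewrite /hform !(rmorphXn, rmorphM, rmorphB, rmorphD, rmorphN). Qed.

(* The duplication [X |-> (X^2 - 1)^2 / (4 (X^3 - X^2 + X))] on [Y^2 = X^3 - X^2 + X],
   for [X = u / v]; [hform u v] is [v^4 (X^3 - X^2 + X)]. *)
Definition doubling (z : int * int) : int * int :=
  ((z.1 ^+ 2 - z.2 ^+ 2) ^+ 2, 4 * hform z.1 z.2).

(** Up to sign [Y(2P) = (X^2 - 1) (X^4 - 2 X^3 + 6 X^2 - 2 X + 1) / (8 Y^3)], so [Y(2P) / Y] is
    rational in [X]. The witness is [16 v^6 Y^3 Y(2P)]. *)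
Lemma hform_doubling (z : int * int) : exists r : int,
  hform (doubling z).1 (doubling z).2 = hform z.1 z.2 * r ^+ 2.
Proof.
case: z => u v; exists (2 * (u ^+ 2 - v ^+ 2) *
  (u ^+ 4 - 2 * u ^+ 3 * v + 6 * u ^+ 2 * v ^+ 2 - 2 * u * v ^+ 3 + v ^+ 4)).
by rewrite /hform /doubling /hform /=; ring.
Qed.

Section Member.
Variables (alpha : algC) (h : int).
Hypothesis alpha2 : alpha ^+ 2 = h%:~R.
Hypothesis h_nonsquare : forall r : rat, r ^+ 2 != h%:~R.
Variables (u v r : int).
Hypothesis uv_h : hform u v = h * r ^+ 2.
Hypotheses (uv19 : u%:~R = 9%:R * v%:~R :> 'F_19) (v19 : v%:~R != 0 :> 'F_19).

(** The square of [a b c], namely [(a^2 - 1)^2 / m^2] for the parameters of the family. It ignores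
    the order of the triple, and squaring removes [alpha]. *)
Definition triple_invariant : algC :=
  ((4 * u ^+ 2 * v ^+ 2 - (u - v) ^+ 4) ^+ 2)%:~R / (4 * hform u v * (u - v) ^+ 4)%:~R.

Lemma family_member : exists a b c : algC,
  [/\ diophantine_triple (quad alpha) a b c, torsion_Z2xZ12 (quad alpha) a b c &
      (a * b * c) ^+ 2 = triple_invariant].
Proof.
have F19 i j : (i = j %[mod 19])%N -> i%:R = j%:R :> 'F_19 by exact: F19_nat_eq.
(* At [u = 9 v] the form is [657 v^4], and 657 is 49 modulo 19. *)
have hv : (hform u v)%:~R = (7%:R * v%:~R ^+ 2) ^+ 2 :> 'F_19.
  rewrite hform_intr uv19.
  rewrite (_ : _ * _ = 657%:R * v%:~R ^+ 4); last by ring.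
  by rewrite (F19 657 49)%N //; ring.
have r0 : r%:~R != 0 :> 'F_19.
  apply: contra v19 => /eqP r0; move: hv; rewrite uv_h rmorphM rmorphXn /= r0 expr0n mulr0.
  by move/eqP; rewrite eq_sym sqrf_eq0 mulf_eq0 sqrf_eq0 (negbTE (@F19_neq0 7 isT)).
(* A square root of [h] modulo 19, read off from [h r^2 = (7 v^2)^2]. *)
pose s : 'F_19 := 7%:R * v%:~R ^+ 2 / r%:~R.
have s2 : s ^+ 2 = h%:~R.
  rewrite /s expr_div_n -hv uv_h rmorphM rmorphXn /= mulfK // sqrf_eq0 //.
have s0 : s != 0.
  by rewrite /s !mulf_neq0 ?invr_eq0 ?sqrf_eq0 //; exact: (@F19_neq0 7).
have p19 : prime 19 by [].
pose pl := quad_place alpha2 h_nonsquare p19 isT s2 s0.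
have Ksub := quad_subfield alpha2 h_nonsquare.
have Kalpha := quad_alpha alpha.
have Kz z := @subfield_int (quad alpha) z Ksub.
pose d : int := u - v.
have d19 : d%:~R != 0 :> 'F_19.
  rewrite /d rmorphB /= uv19 (_ : _ - _ = 8%:R * v%:~R); last by ring.
  by rewrite mulf_neq0 //; exact: (@F19_neq0 8).
have int0 z : z%:~R != 0 :> 'F_19 -> z%:~R != 0 :> algC.
  by rewrite !intr_eq0; apply: contra => /eqP->.
have d0 := int0 _ d19; have v0 := int0 _ v19; have r0' := int0 _ r0.
have h0 : (hform u v)%:~R != 0 :> algC.
  apply: int0; rewrite hv sqrf_eq0 mulf_neq0 ?sqrf_eq0 //; exact: (@F19_neq0 7).
pose U : algC := u%:~R; pose V : algC := v%:~R.
have dE : d%:~R = U - V :> algC by rewrite /d rmorphB.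
rewrite dE in d0.
(* The parametrization by the genus one curve in homogeneous form, with [X = U / V] and
   [Y = r alpha / V^2]. *)
pose a : algC := 2%:R * U * V / (U - V) ^+ 2.
pose w : algC := (U + V) / (U - V).
pose m : algC := 2%:R * r%:~R * alpha / (U - V) ^+ 2.
have hE : (hform u v)%:~R = U * V * (U ^+ 2 - U * V + V ^+ 2).
  exact: hform_intr.
have w2 : w ^+ 2 = 2%:R * a + 1 by rewrite /w /a; field.
have m2 : m ^+ 2 = a * (a + 2%:R).
  have -> : m ^+ 2 = 4%:R * (h%:~R * r%:~R ^+ 2) / (U - V) ^+ 4.
    by rewrite /m -alpha2; field.
  by rewrite -rmorphXn -rmorphM -uv_h /= hE /a; field.
have Kd : quad alpha (U - V) by rewrite -dE.
have Ka : quad alpha a.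
  repeat first [assumption | exact: Kz | exact: (subfield_nat Ksub) | apply: (subfieldM Ksub)
     | apply: (subfieldV Ksub) | apply: (subfieldX Ksub) | assumption].
have Kw : quad alpha w.
  by repeat first [assumption | exact: Kz | apply: (subfieldM Ksub)
     | apply: (subfieldV Ksub) | apply: (subfieldD Ksub) | assumption].
have Km : quad alpha m.
  by repeat first [assumption | exact: Kz | exact: (subfield_nat Ksub) | apply: (subfieldM Ksub)
     | apply: (subfieldV Ksub) | apply: (subfieldX Ksub) | assumption].
have Od2 : pl_int pl ((d ^+ 2)%:~R) := pl_int_int pl _.
have rd2 : pl_res pl ((d ^+ 2)%:~R) != 0 by rewrite pl_res_int rmorphXn sqrf_eq0.
have aE : a = (2 * u * v)%:~R * ((d ^+ 2)%:~R)^-1.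
  by rewrite /a rmorphXn !rmorphM /= dE.
have Oa : pl_int pl a.
  by rewrite aE; apply: pl_intM; [exact: pl_int_int | exact: pl_intV].
have ra : pl_res pl a = 8%:R.
  apply: (mulIf rd2); rewrite -pl_resM // {1}aE mulfVK; last first.
    by rewrite rmorphXn /= dE sqrf_eq0.
  (* Since [u = 9 v], the claim compares [2 u v = 18 v^2] with [8 (u - v)^2 = 512 v^2], equal modulo
     19. *)
  rewrite !pl_res_int /d !(rmorphM, rmorphXn, rmorphB, rmorphD, rmorphN) /= uv19.
  rewrite (_ : _ * _ = 18%:R * v%:~R ^+ 2); last by ring.
  by rewrite (F19 18 512)%N //; ring.
exists (m^-1), (- m), ((1 - a ^+ 2) / m); split.
- exact: (family_diophantine Ksub Ka Km Kw Oa ra w2 m2).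
- exact: (family_torsion Ksub Ka Km Kw Oa ra w2 m2).
have m0 : m != 0 := m_neq0 Oa ra m2.
rewrite (_ : _ ^+ 2 = (a ^+ 2 - 1) ^+ 2 / m ^+ 2); last by field.
rewrite /triple_invariant m2.
move: (hform u v) hE h0 => H hE h0.
rewrite !(rmorphXn, rmorphM, rmorphB) /= hE -/U -/V /a -[4%:~R]/(4%:R).
rewrite hE !mulf_eq0 !negb_or in h0; case/andP: h0 => /andP[U0 V0] W0.
have W1 : 2%:R * U * V + 2%:R * (U - V) ^+ 2 != 0.
  rewrite (_ : _ + _ = 2%:R * (U ^+ 2 - U * V + V ^+ 2)); last by ring.
  by rewrite mulf_neq0 // pnatr_eq0.
by field; rewrite -?/U -?/V U0 V0 W0 d0 W1.
Qed.

End Member.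

Section Orbit.
Variables (alpha : algC) (z0 : int * int).
Local Notation h := (hform z0.1 z0.2).
Hypothesis alpha2 : alpha ^+ 2 = h%:~R.
Hypothesis h_nonsquare : forall r : rat, r ^+ 2 != h%:~R.
Hypotheses (z19 : z0.1%:~R = 9%:R * z0.2%:~R :> 'F_19) (v19 : z0.2%:~R != 0 :> 'F_19).
Hypotheses (u2 : z0.1%:~R = 1 :> 'F_2) (v2 : z0.2%:~R = 0 :> 'F_2) (v_neq0 : z0.2 != 0).

Local Notation orbit k := (iter k doubling z0).

Lemma orbit_hform k : exists r : int, hform (orbit k).1 (orbit k).2 = h * r ^+ 2.
Proof.
elim: k => [|k [r IH]]; first by exists 1; rewrite mulr1.
have [r' H] := hform_doubling (orbit k); exists (r * r').
by rewrite iterS H IH; ring.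
Qed.

(** For [u = 9 v] the next pair is [(80 v^2)^2 = 16 v^4] and [4 * 657 v^4 = 6 v^4], and [9 * 6 = 54]
    is 16 modulo 19. *)
Lemma orbit19 k : (orbit k).1%:~R = 9%:R * (orbit k).2%:~R :> 'F_19 /\
  (orbit k).2%:~R != 0 :> 'F_19.
Proof.
elim: k => [//|k]; rewrite iterS; case: (orbit k) => u v /= [uE v0].
have hE : (4 * hform u v)%:~R = 6%:R * v%:~R ^+ 4 :> 'F_19.
  rewrite rmorphM /= hform_intr uE -[4%:~R]/(4%:R).
  rewrite (_ : _ * _ = 4%:R * 657%:R * v%:~R ^+ 4); last by ring.
  by rewrite (@F19_nat_eq 657 11) // -natrM (@F19_nat_eq (4 * 11) 6).
have six : (6%:R : 'F_19) != 0 by exact: (@F19_neq0 6).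
rewrite hE; split; last by rewrite mulf_neq0 // expf_neq0.
rewrite !(rmorphXn, rmorphM, rmorphB) /= uE.
rewrite (_ : _ ^+ 2 = (80%:R * v%:~R ^+ 2) ^+ 2); last by ring.
rewrite (@F19_nat_eq 80 4) // (_ : 9%:R * _ = 54%:R * v%:~R ^+ 4); last by ring.
by rewrite (@F19_nat_eq 54 16) //; ring.
Qed.

(** With [u] odd and [v] even, [u^2 - u v + v^2] is odd, so the next denominator
    [4 u v (u^2 - u v + v^2)] gains exactly two factors 2, and the next numerator stays odd. *)
Lemma orbit2 k : [/\ (orbit k).1%:~R = 1 :> 'F_2, (orbit k).2%:~R = 0 :> 'F_2,
  (orbit k).2 != 0 & logn 2 `|(orbit k).2| = (logn 2 `|z0.2| + k.*2)%N].
Proof.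
elim: k => [|k]; first by rewrite addn0.
rewrite iterS; case: (orbit k) => u v /= [uE vE v0 vlog].
have odd_log (z : int) : z%:~R != 0 :> 'F_2 -> z != 0 /\ logn 2 `|z| = 0%N.
  move=> z2; split; first by apply: contra z2 => /eqP->.
  by rewrite lognE; move: z2; rewrite Fp_int_eq0 // => /negbTE ->; rewrite !andbF.
have [u0 ulog] : u != 0 /\ logn 2 `|u| = 0%N by apply: odd_log; rewrite uE oner_neq0.
have [q0 qlog] : u ^+ 2 - u * v + v ^+ 2 != 0 /\ logn 2 `|u ^+ 2 - u * v + v ^+ 2| = 0%N.
  apply: odd_log; rewrite !(rmorphXn, rmorphM, rmorphB, rmorphD, rmorphN) /= uE vE.
  by rewrite mulr0 expr0n addr0 subr0 expr1n oner_neq0.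
split.
- by rewrite !(rmorphXn, rmorphB) /= uE vE expr0n subr0 !expr1n.
- by rewrite rmorphM /= hform_intr vE mulr0 !mul0r mulr0.
- by rewrite /hform !mulf_neq0.
rewrite /hform !abszM !lognM ?muln_gt0 ?absz_gt0 ?u0 ?v0 ?q0 // ulog qlog vlog.
by rewrite (_ : logn 2 `|4| = 2%N) // doubleS; lia.
Qed.

Definition orbit_invariant k : algC := triple_invariant (orbit k).1 (orbit k).2.

(** The numerator and [(u - v)^4] are odd, and the remaining factor [4 hform u v] is the denominator
    of the next orbit element. This is why [k.+1] appears in the 2-adic valuation, which determines
    [k]. *)
Lemma orbit_invariant_inj : injective orbit_invariant.
Proof.
have split_inv k : exists n d : int, [/\ orbit_invariant k = n%:~R / d%:~R, n != 0, d != 0 &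
    logn 2 `|n| = 0%N /\ logn 2 `|d| = (logn 2 `|z0.2| + k.+1.*2)%N].
  have [_ _ H0 Hlog] := orbit2 k.+1; have [uE vE _ _] := orbit2 k.
  move: H0 Hlog; rewrite iterS /orbit_invariant /triple_invariant.
  case: (orbit k) uE vE => u v /= uE vE H0 Hlog.
  have odd_log (z : int) : z%:~R = 1 :> 'F_2 -> z != 0 /\ logn 2 `|z| = 0%N.
    move=> z1; have z2 : z%:~R != 0 :> 'F_2 by rewrite z1 oner_neq0.
    split; first by apply: contra z2 => /eqP->.
    by rewrite lognE; move: z2; rewrite Fp_int_eq0 // => /negbTE ->; rewrite !andbF.
  have [n0 nlog] : (4 * u ^+ 2 * v ^+ 2 - (u - v) ^+ 4) ^+ 2 != 0 /\
      logn 2 `|(4 * u ^+ 2 * v ^+ 2 - (u - v) ^+ 4) ^+ 2| = 0%N.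
    apply: odd_log; rewrite !(rmorphXn, rmorphM, rmorphB) /= uE vE.
    by rewrite expr0n mulr0 subr0 expr1n sub0r sqrrN expr1n.
  have [d0 dlog] : (u - v) ^+ 4 != 0 /\ logn 2 `|(u - v) ^+ 4| = 0%N.
    by apply: odd_log; rewrite !(rmorphXn, rmorphB) /= uE vE subr0 expr1n.
  exists ((4 * u ^+ 2 * v ^+ 2 - (u - v) ^+ 4) ^+ 2), (4 * hform u v * (u - v) ^+ 4).
  split=> //; first by rewrite mulf_neq0.
  by split=> //; rewrite abszM lognM ?absz_gt0 // dlog addn0 Hlog.
move=> k l kl; have [n [d [E n0 d0 [nlog dlog]]]] := split_inv k.
have [n' [d' [E' n'0 d'0 [nlog' dlog']]]] := split_inv l.
have : n * d' = n' * d.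
  apply: (@intr_inj algC); rewrite !rmorphM /=.
  have dC : d%:~R != 0 :> algC by rewrite intr_eq0.
  have dC' : d'%:~R != 0 :> algC by rewrite intr_eq0.
  move: kl; rewrite E E' => /(congr1 (fun x => x * (d%:~R * d'%:~R))).
  by rewrite mulrA divfK // => ->; field.
move/(congr1 (fun z : int => logn 2 `|z|)); rewrite !abszM !lognM ?absz_gt0 //.
rewrite nlog nlog' dlog dlog'; lia.
Qed.

(** Pigeonhole: one more orbit element than the length of [s] gives an invariant attained by no
    triple of [s]. *)
Lemma orbit_triple (s : seq (algC * algC * algC)) : exists a b c : algC,
  [/\ diophantine_triple (quad alpha) a b c, torsion_Z2xZ12 (quad alpha) a b c &
      all (fun t => ~~ perm_eq [:: a; b; c] [:: t.1.1; t.1.2; t.2]) s].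
Proof.
pose L := [seq (t.1.1 * t.1.2 * t.2) ^+ 2 | t <- s].
have [k kL] : exists k, orbit_invariant k \notin L.
  pose V := [seq orbit_invariant k | k <- iota 0 (size L).+1].
  have : ~~ all (mem L) V.
    apply/negP => /allP /= sub; have := uniq_leq_size _ sub.
    rewrite (map_inj_uniq orbit_invariant_inj) iota_uniq => /(_ isT).
    by rewrite size_map size_iota ltnn.
  by case/allPn => _ /mapP[k _ ->] kL; exists k.
have [r Hr] := orbit_hform k; have [H19 V19] := orbit19 k.
have [a [b [c [H1 H2 H3]]]] := family_member alpha2 h_nonsquare Hr H19 V19.
exists a, b, c; split=> //; apply/allP => t ts; apply: contra kL => perm.
rewrite /orbit_invariant -H3; apply/mapP; exists t => //; congr (_ ^+ 2).
have prodE (x y z : algC) : x * y * z = \prod_(i <- [:: x; y; z]) i.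
  by rewrite !big_cons big_nil mulr1 mulrA.
by rewrite !prodE (perm_big _ perm).
Qed.

End Orbit.

Lemma odd_logn_nonsquare (l : nat) (h : int) : odd (logn l `|h|) ->
  forall r : rat, r ^+ 2 != h%:~R.
Proof.
move=> odd_h r; apply: contraL odd_h => /eqP rh.
have h_num : numq r ^+ 2 = h * denq r ^+ 2.
  have d0 : (denq r)%:~R != 0 :> rat by rewrite intr_eq0 denq_neq0.
  have nE : (numq r)%:~R = r * (denq r)%:~R by rewrite -[X in _ = X * _]divq_num_den divfK.
  by apply: (@intr_inj rat); rewrite !(rmorphXn, rmorphM) /= -rh nE exprMn.
have [->|h0] := eqVneq h 0; first by rewrite logn0.
have d0 : denq r ^+ 2 != 0 by rewrite sqrf_eq0 denq_neq0.
move/(congr1 (fun z : int => odd (logn l `|z|))): h_num.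
by rewrite abszM lognM ?absz_gt0 // !abszX !lognX oddD !oddM /= addbF => <-.
Qed.

(** * Infinitely many fields *)

(* 36 is even and inverse to 9 modulo 19. *)
Definition start (l : nat) : int * int := (l%:Z, (36 * (l %% 19))%N%:Z).
Definition start_h (l : nat) : int := hform (start l).1 (start l).2.
Definition start_alpha (l : nat) : algC := sqrtC (start_h l)%:~R.

(** [hform l v] is [l v (l^2 - l v + v^2)], where [l] does not divide [v = 36 (l mod 19)] by size,
    and the last factor is [v^2] modulo [l]. *)
Lemma start_logn l : prime l -> (36 < l)%N -> logn l `|start_h l| = 1%N.
Proof.
move=> lp l36; have l19 : ~~ (l %| 19)%N by rewrite gtnNdvd // ltnW // ltnW //; lia.
have v0 : ~~ (l %| 36 * (l %% 19))%N.
  rewrite Euclid_dvdM // negb_or gtnNdvd //=.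
  have [r0|r0] := posnP (l %% 19)%N.
    have : (19 %| l)%N by rewrite /dvdn r0.
    by rewrite dvdn_prime2 // => /eqP lE; move: l36; rewrite -lE.
  by rewrite gtnNdvd //; have := ltn_pmod l (isT : 0 < 19)%N; lia.
rewrite /start_h /hform [(start l).1]/= [(start l).2]/=; move: (36 * (l %% 19))%N v0 => v v0.
have q0 : ~~ (l %| `|(l%:Z ^+ 2 - l%:Z * v%:Z + v%:Z ^+ 2)%R|)%N.
  rewrite -Fp_int_eq0 // !(rmorphXn, rmorphM, rmorphB, rmorphD) /=.
  have l0 := Fp_int_eq0 l%:Z lp; rewrite absz_nat dvdnn in l0; rewrite (eqP l0).
  by rewrite expr0n mul0r subr0 add0r sqrf_eq0 Fp_int_eq0.
have nz n : ~~ (l %| n)%N -> (0 < n)%N by case: n => //; rewrite dvdn0.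
have log0 n : ~~ (l %| n)%N -> logn l n = 0%N by rewrite lognE => /negbTE ->; rewrite !andbF.
rewrite !abszM !lognM ?muln_gt0 ?(nz _ q0) ?(nz _ v0) ?prime_gt0 // !absz_nat.
by rewrite (log0 _ q0) (log0 _ v0) logn_prime // eqxx.
Qed.

Lemma start_nonsquare l : prime l -> (36 < l)%N -> forall r : rat, r ^+ 2 != (start_h l)%:~R.
Proof. by move=> lp l36; apply: (@odd_logn_nonsquare l); rewrite start_logn. Qed.

Lemma start_alpha2 l : start_alpha l ^+ 2 = (start_h l)%:~R.
Proof. exact: sqrtCK. Qed.

Lemma start_triple l (s : seq (algC * algC * algC)) : prime l -> (36 < l)%N ->
  exists a b c : algC,
  [/\ diophantine_triple (quad (start_alpha l)) a b c,
      torsion_Z2xZ12 (quad (start_alpha l)) a b c &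
      all (fun t => ~~ perm_eq [:: a; b; c] [:: t.1.1; t.1.2; t.2]) s].
Proof.
move=> lp l36; have r0 : (l %% 19 != 0)%N.
  apply: contraL l36 => r0; have : (19 %| l)%N by [].
  by rewrite dvdn_prime2 // => /eqP <-.
apply: (@orbit_triple _ (start l)) => /=.
- exact: start_alpha2.
- exact: start_nonsquare.
- rewrite -!pmulrn -natrM; apply: Fp_nat_eq => //; rewrite mulnA; lia.
- by rewrite Fp_int_eq0 // absz_nat Euclid_dvdM //= /dvdn modn_mod.
- rewrite -!pmulrn -[1]/(1%:R); apply: Fp_nat_eq => //; rewrite !modn2.
  by have /odd_prime_gt2 := lp; case: (even_prime lp) => [l2|->]; [move: l36; rewrite l2|].
- by rewrite -pmulrn -[0]/(0%:R); apply: Fp_nat_eq => //; lia.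
- by apply/eqP; move/eqP: r0; lia.
Qed.

(** Each prime exceeds [start_h] of its predecessor in absolute value, hence of all earlier primes,
    as the sequence increases; so it divides none of these values. *)
Fixpoint prime_seq (n : nat) : nat :=
  s2val (prime_above (if n is n'.+1 then prime_seq n' + `|start_h (prime_seq n')| else 36)).

Lemma prime_seq_prime n : prime (prime_seq n).
Proof. by case: n => [|n] /=; case: (prime_above _). Qed.

Lemma prime_seqS n : (prime_seq n + `|start_h (prime_seq n)| < prime_seq n.+1)%N.
Proof. by rewrite [prime_seq n.+1]/=; case: (prime_above _). Qed.

Lemma prime_seq_gt m n : (m < n)%N -> (prime_seq m + `|start_h (prime_seq m)| < prime_seq n)%N.
Proof.
elim: n => // n IH; rewrite ltnS leq_eqVlt => /orP[/eqP->|/IH H]; first exact: prime_seqS.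
by apply: ltn_trans H _; apply: leq_ltn_trans (prime_seqS n); apply: leq_addr.
Qed.

Lemma prime_seq_gt36 n : (36 < prime_seq n)%N.
Proof.
case: n => [|n]; first by rewrite /=; case: (prime_above _).
have seq0 : (36 < prime_seq 0)%N by rewrite /=; case: (prime_above _).
apply: ltn_trans seq0 _; exact: leq_ltn_trans (leq_addr _ _) (prime_seq_gt (ltn0Sn n)).
Qed.

(** Squaring [alpha_l = p + q alpha_k] gives [h_l = p^2 + q^2 h_k] and [p q = 0]. If [q = 0], then
    [h_l] is a rational square; if [p = 0], then [h_l h_k] is one, although [l] divides it exactly
    once. *)
Lemma prime_seq_alpha_notin m n : (m < n)%N ->
  ~ quad (start_alpha (prime_seq m)) (start_alpha (prime_seq n)).
Proof.
move=> mn [p [q E]].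
have lp k := prime_seq_prime k; have l36 k := prime_seq_gt36 k.
move: (lp n) (l36 n) (lp m) (l36 m) (prime_seq_gt mn) E.
move: (prime_seq n) (prime_seq m) => l k lp' l36' kp k36 kl E.
pose hl := start_h l; pose hk := start_h k.
have hk_log : logn l `|hk| = 0%N by apply: ltn_log0; apply: leq_ltn_trans kl; apply: leq_addl.
have hk0 : hk != 0.
  by apply/eqP => hk0; have := start_logn kp k36; rewrite -/hk hk0 absz0 logn0.
have hl_log : logn l `|hl| = 1%N := start_logn lp' l36'.
have hl0 : hl != 0 by apply/eqP => hl0; move: hl_log; rewrite hl0 absz0 logn0.
have al2 : start_alpha l ^+ 2 = hl%:~R := start_alpha2 l.
have ak2 : start_alpha k ^+ 2 = hk%:~R := start_alpha2 k.
have l_nonsq : forall r : rat, r ^+ 2 != hl%:~R := start_nonsquare lp' l36'.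
have indep := quad_indep (start_alpha2 k) (start_nonsquare kp k36).
clearbody hl hk.
have [|H1 /eqP H2] := indep (p ^+ 2 + q ^+ 2 * hk%:~R - hl%:~R) (2%:R * p * q).
  rewrite !(rmorphXn, rmorphM, rmorphB, rmorph_nat) rmorphD !(rmorphXn, rmorphM) /= !ratr_int.
  by rewrite -al2 -ak2 E; ring.
move: H2; rewrite !mulf_eq0 /= => /orP[/eqP p0|/eqP q0].
  have odd_log : odd (logn l `|hl * hk|) by rewrite abszM lognM ?absz_gt0 // hl_log hk_log.
  have /eqP[] := odd_logn_nonsquare odd_log (q * hk%:~R).
  move/eqP: H1; rewrite p0 expr0n add0r subr_eq0 => /eqP H1.
  by rewrite rmorphM /= -H1; ring.
have /eqP[] := l_nonsq p.
by move/eqP: H1; rewrite q0 expr0n mul0r addr0 subr_eq0 => /eqP.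
Qed.

Theorem theorem2 :
  exists F : nat -> (algC -> Prop),
    [/\ (forall n, quadratic_field (F n)),
        (forall m n, m <> n -> exists x, ~ (F m x <-> F n x)) &
        (forall n (s : seq (algC * algC * algC)),
           exists a b c : algC,
             [/\ diophantine_triple (F n) a b c,
                 torsion_Z2xZ12 (F n) a b c &
                 all (fun t => ~~ perm_eq [:: a; b; c] [:: t.1.1; t.1.2; t.2]) s])].
Proof.
exists (fun n => quad (start_alpha (prime_seq n))); split.
- move=> n; apply: quad_quadratic (start_alpha2 _) (start_nonsquare _ _).
    exact: prime_seq_prime.
  exact: prime_seq_gt36.
- move=> m n /eqP; rewrite neq_ltn => /orP[mn|nm].
    exists (start_alpha (prime_seq n)) => -[_ H].
    exact: prime_seq_alpha_notin mn (H (quad_alpha _)).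
  exists (start_alpha (prime_seq m)) => -[H _].
  exact: prime_seq_alpha_notin nm (H (quad_alpha _)).
- by move=> n s; apply: start_triple; [exact: prime_seq_prime | exact: prime_seq_gt36].
Qed.
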